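(* Let $\mathcal C$ be a non-pointed modular tensor category such that $\mathcal C_{\mathrm{pt}}\subseteq\mathcal C_{\mathrm{ad}}$ and $\operatorname{FPdim}(\mathcal C_{\mathrm{pt}})=p^k$ for some odd prime $p$ and $k\in\mathbb N$. Consider the universal grading $\mathcal C=\bigoplus_{g\in\mathcal G(\mathcal C)}\mathcal C_g$. Then $\operatorname{rank}(\mathcal C_g)\equiv 0 \pmod p$ for all $g\in\mathcal G(\mathcal C)$ with $g\neq 1$.
   Context: All categories are over an algebraically closed field of characteristic zero. A modular tensor category is a braided fusion category with a spherical structure whose $S$-matrix is invertible. $\mathcal G(\mathcal C)$ is the group of isomorphism classes of invertible objects, $\mathcal C_{\mathrm{pt}}$ the fusion subcategory generated by the invertible objects, and $\mathcal C_{\mathrm{ad}}$ the adjoint subcategory, generated by all $X\otimes X^*$ with $X$ simple. $\mathcal C$ is pointed if $\mathcal C_{\mathrm{pt}}=\mathcal C$. The universal grading is the canonical faithful grading with trivial component $\mathcal C_{\mathrm{ad}}$; for modular $\mathcal C$ its grading group is isomorphic to $\mathcal G(\mathcal C)$. $\operatorname{FPdim}$ is the Frobenius-Perron dimension, and $\operatorname{rank}(\mathcal C_g)$ is the number of isomorphism classes of simple objects in $\mathcal C_g$. *)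

(* Defs.v *)
From HB Require Import structures.
From mathcomp Require Import all_boot all_order all_algebra all_field.
From mathcomp Require Import boolp.

Set Implicit Arguments.
Unset Strict Implicit.
Unset Printing Implicit Defensive.

Import Order.TTheory GRing.Theory Num.Theory.
Local Open Scope ring_scope.

(* Categories enriched over finite-dimensional K-vector spaces.               *)

Record linearCategory (K : closedFieldType) := LinearCategory {
  obj :> Type;
  hom : obj -> obj -> vectType K;
  idm : forall X, hom X X;
  comp : forall X Y Z, hom Y Z -> hom X Y -> hom X Z;
  comp_idl : forall X Y (f : hom X Y), comp (idm Y) f = f;
  comp_idr : forall X Y (f : hom X Y), comp f (idm X) = f;
  compA : forall W X Y Z (h : hom Y Z) (g : hom X Y) (f : hom W X),
    comp h (comp g f) = comp (comp h g) f;
  comp_linl : forall X Y Z a (g g' : hom Y Z) (f : hom X Y),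
    comp (a *: g + g') f = a *: comp g f + comp g' f;
  comp_linr : forall X Y Z a (g : hom Y Z) (f f' : hom X Y),
    comp g (a *: f + f') = a *: comp g f + comp g f'
}.

Arguments hom {K l} X Y : rename.
Arguments idm {K l} X : rename.
Arguments comp {K l X Y Z} g f : rename.

Declare Scope cat_scope.
Delimit Scope cat_scope with cat.
Local Open Scope cat_scope.

Notation "g \c f" := (comp g f) (at level 50, left associativity) : cat_scope.

Section LinearNotions.
Variables (K : closedFieldType) (C : linearCategory K).
Implicit Types (X Y Z W : C).

Definition inverses X Y (f : hom X Y) (g : hom Y X) :=
  g \c f = idm X /\ f \c g = idm Y.
Definition is_iso X Y (f : hom X Y) := exists g, inverses f g.
Definition isomorphic X Y := exists f : hom X Y, is_iso f.

Definition mono X Y (f : hom X Y) :=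
  forall W (g h : hom W X), f \c g = f \c h -> g = h.
Definition epi X Y (f : hom X Y) :=
  forall Z (g h : hom Y Z), g \c f = h \c f -> g = h.

Definition is_zero X := idm X = 0.

Definition is_kernel X Y W (f : hom X Y) (k : hom W X) :=
  f \c k = 0 /\
  forall V (g : hom V X), f \c g = 0 -> exists! h : hom V W, g = k \c h.
Definition is_cokernel X Y Z (f : hom X Y) (q : hom Y Z) :=
  q \c f = 0 /\
  forall V (g : hom Y V), g \c f = 0 -> exists! h : hom Z V, g = h \c q.

(* S is the direct sum (biproduct) of Y_0, ..., Y_(n-1); a zero object        *)
(* when n = 0.                                                                *)
Definition is_direct_sum n (Y : 'I_n -> C) (S : C) :=
  exists (inj : forall i, hom (Y i) S) (proj : forall i, hom S (Y i)),
  [/\ forall i, proj i \c inj i = idm (Y i),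
      forall i j, i != j -> proj i \c inj j = 0 &
      \sum_i (inj i \c proj i) = idm S].

Definition is_summand X S :=
  exists (i : hom X S) (r : hom S X), r \c i = idm X.

Definition simple X :=
  ~ is_zero X /\
  forall Y (f : hom Y X), mono f -> is_zero Y \/ is_iso f.

Record abelian : Prop := Abelian {
  ab_sum : forall n (Y : 'I_n -> C), exists S, is_direct_sum Y S;
  ab_ker : forall X Y (f : hom X Y), exists W (k : hom W X), is_kernel f k;
  ab_coker : forall X Y (f : hom X Y),
    exists Z (q : hom Y Z), is_cokernel f q;
  ab_mono : forall X Y (f : hom X Y), mono f ->
    exists Z (g : hom Y Z), is_kernel g f;
  ab_epi : forall X Y (f : hom X Y), epi f ->
    exists W (g : hom W X), is_cokernel g f
}.

Definition semisimple :=
  forall X, exists n (Y : 'I_n -> C),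
    (forall i, simple (Y i)) /\ is_direct_sum Y X.

End LinearNotions.

Record monoidalCategory (K : closedFieldType) := MonoidalCategory {
  mcat :> linearCategory K;
  one : mcat;
  ten : mcat -> mcat -> mcat;
  tenm : forall X X' Y Y' : mcat,
    hom X X' -> hom Y Y' -> hom (ten X Y) (ten X' Y');
  assoc : forall X Y Z, hom (ten (ten X Y) Z) (ten X (ten Y Z));
  assocV : forall X Y Z, hom (ten X (ten Y Z)) (ten (ten X Y) Z);
  lunit : forall X, hom (ten one X) X;
  lunitV : forall X, hom X (ten one X);
  runit : forall X, hom (ten X one) X;
  runitV : forall X, hom X (ten X one);
  tenm_id : forall X Y, tenm (idm X) (idm Y) = idm (ten X Y);
  tenm_comp : forall X X' X'' Y Y' Y'' (f' : hom X' X'') (f : hom X X')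
    (g' : hom Y' Y'') (g : hom Y Y'),
    tenm (f' \c f) (g' \c g) = tenm f' g' \c tenm f g;
  tenm_linl : forall X X' Y Y' a (f f' : hom X X') (g : hom Y Y'),
    tenm (a *: f + f') g = a *: tenm f g + tenm f' g;
  tenm_linr : forall X X' Y Y' a (f : hom X X') (g g' : hom Y Y'),
    tenm f (a *: g + g') = a *: tenm f g + tenm f g';
  assocK : forall X Y Z, inverses (assoc X Y Z) (assocV X Y Z);
  lunitK : forall X, inverses (lunit X) (lunitV X);
  runitK : forall X, inverses (runit X) (runitV X);
  assoc_nat : forall X X' Y Y' Z Z'
    (f : hom X X') (g : hom Y Y') (h : hom Z Z'),
    assoc X' Y' Z' \c tenm (tenm f g) h = tenm f (tenm g h) \c assoc X Y Z;
  lunit_nat : forall X Y (f : hom X Y),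
    lunit Y \c tenm (idm one) f = f \c lunit X;
  runit_nat : forall X Y (f : hom X Y),
    runit Y \c tenm f (idm one) = f \c runit X;
  pentagon : forall W X Y Z,
    assoc W X (ten Y Z) \c assoc (ten W X) Y Z =
    tenm (idm W) (assoc X Y Z) \c assoc W (ten X Y) Z
      \c tenm (assoc W X Y) (idm Z);
  triangle : forall X Y,
    tenm (idm X) (lunit Y) \c assoc X one Y = tenm (runit X) (idm Y)
}.

Arguments one {K m} : rename.
Arguments ten {K m} X Y : rename.
Arguments tenm {K m X X' Y Y'} f g : rename.
Arguments assoc {K m} X Y Z : rename.
Arguments assocV {K m} X Y Z : rename.
Arguments lunit {K m} X : rename.
Arguments lunitV {K m} X : rename.
Arguments runit {K m} X : rename.
Arguments runitV {K m} X : rename.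

Notation "X \ox Y" := (ten X Y) (at level 40, left associativity) : cat_scope.
Notation "f \om g" := (tenm f g) (at level 40, left associativity) : cat_scope.

(* Y, with evaluation ev and coevaluation coev, is a left dual of X           *)
(* (equivalently, X is a right dual of Y).                                    *)
Definition is_left_dual (K : closedFieldType) (C : monoidalCategory K)
    (X Y : C) (ev : hom (Y \ox X) one) (coev : hom one (X \ox Y)) :=
  runit X \c (idm X \om ev) \c assoc X Y X \c (coev \om idm X) \c lunitV X
    = idm X /\
  lunit Y \c (ev \om idm Y) \c assocV Y X Y \c (idm Y \om coev) \c runitV Y
    = idm Y.

(* The fields rank and irr choose representatives irr i, i < rank, of the     *)
(* isomorphism classes of simple objects, the fields dual, ev and coev choose *)
(* left duals.                                                                *)
Record fusionCategory (K : closedFieldType) := FusionCategory {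
  fcat :> monoidalCategory K;
  fus_abelian : abelian fcat;
  fus_semisimple : semisimple fcat;
  rank : nat;
  irr : 'I_rank -> fcat;
  irr_simple : forall i, simple (irr i);
  irr_inj : forall i j, isomorphic (irr i) (irr j) -> i = j;
  irr_surj : forall X, simple X -> exists i, isomorphic X (irr i);
  one_simple : simple (one : fcat);
  dual : fcat -> fcat;
  ev : forall X, hom (dual X \ox X) one;
  coev : forall X, hom one (X \ox dual X);
  dualP : forall X, is_left_dual (ev X) (coev X);
  rdual_ex : forall X : fcat, exists (Y : fcat)
    (e : hom (X \ox Y) one) (c : hom one (Y \ox X)), is_left_dual e c
}.

Arguments irr {K} f i : rename.
Arguments dual {K f} X : rename.
Arguments ev {K f} X : rename.
Arguments coev {K f} X : rename.

Section FusionNotions.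
Variables (K : closedFieldType) (C : fusionCategory K).
Implicit Types (X Y Z : C).

(* The morphism A -> B^* corresponding to a pairing A (x) B -> 1.             *)
Definition mate (A B : C) (e : hom (A \ox B) one) : hom A (dual B) :=
  lunit (dual B) \c (e \om idm (dual B)) \c assocV A B (dual B)
    \c (idm A \om coev B) \c runitV A.

Definition dualm X Y (f : hom X Y) : hom (dual Y) (dual X) :=
  mate (ev Y \c (idm (dual Y) \om f)).

Definition ev_ten X Y : hom ((dual Y \ox dual X) \ox (X \ox Y)) one :=
  ev Y \c (idm (dual Y) \om (lunit Y \c (ev X \om idm Y)
                                \c assocV (dual X) X Y))
    \c assoc (dual Y) (dual X) (X \ox Y).

(* The canonical isomorphism Y^* (x) X^* -> (X (x) Y)^*.                      *)
Definition dual_ten X Y : hom (dual Y \ox dual X) (dual (X \ox Y)) :=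
  mate (ev_ten X Y).

Definition invertible X :=
  exists Y, isomorphic (X \ox Y) one /\ isomorphic (Y \ox X) one.

Record fusion_subcategory (P : C -> Prop) : Prop := FusionSubcategory {
  fsub_one : P one;
  fsub_ten : forall X Y, P X -> P Y -> P (X \ox Y);
  fsub_dual : forall X, P X -> P (dual X);
  fsub_sum : forall n (Y : 'I_n -> C) S,
    (forall i, P (Y i)) -> is_direct_sum Y S -> P S;
  fsub_summand : forall X S, P S -> is_summand X S -> P X
}.

(* In particular a fusion subcategory is closed under isomorphism, an object  *)
(* being a direct summand of any object isomorphic to it.                     *)
Definition generated (G : C -> Prop) : C -> Prop := fun X =>
  forall P, fusion_subcategory P -> (forall Y, G Y -> P Y) -> P X.

Definition pt : C -> Prop := generated invertible.
Definition ad : C -> Prop :=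
  generated (fun X => exists2 Z, simple Z & X = Z \ox dual Z).

Definition pointed := forall X, pt X.

(* Multiplicity of the k-th simple object in the tensor product of the i-th   *)
(* and the j-th: in the semisimple case over an algebraically closed field,   *)
(* [X : V] = dim Hom(V, X) for V simple.                                      *)
Definition fusion_coef (i j k : 'I_(rank C)) : nat :=
  \dim {: hom (irr C k) (irr C i \ox irr C j)}.

Definition max_nneg_eigenvalue n (M : 'M[algC]_n) : algC :=
  \big[Num.max/0]_(a <- sval (closed_field_poly_normal (char_poly M))
                  | 0 <= a) a.

Definition FPdim (i : 'I_(rank C)) : algC :=
  max_nneg_eigenvalue (\matrix_(j, k) (fusion_coef i j k)%:R).

Definition FPdim_sub (P : C -> Prop) : algC :=
  \sum_(i | `[< P (irr C i) >]) FPdim i ^+ 2.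

Definition rank_sub (P : C -> Prop) : nat := #|[pred i | `[< P (irr C i) >]]|.

(* A grading of C by a group: a decomposition of C into a direct sum of full  *)
(* subcategories A_g, compatible with the tensor product.                     *)
Record grading (G : groupType) (A : G -> C -> Prop) : Prop := Grading {
  gr_sum : forall g n (Y : 'I_n -> C) S,
    (forall i, A g (Y i)) -> is_direct_sum Y S -> A g S;
  gr_summand : forall g X S, A g S -> is_summand X S -> A g X;
  gr_orth : forall g h X Y, g != h -> A g X -> A h Y ->
    forall f : hom X Y, f = 0;
  gr_decomp : forall X, exists n (g : 'I_n -> G) (Y : 'I_n -> C),
    (forall i, A (g i) (Y i)) /\ is_direct_sum Y X;
  gr_ten : forall g h X Y, A g X -> A h Y -> A (g * h)%g (X \ox Y)
}.

Definition faithful_grading (G : groupType) (A : G -> C -> Prop) :=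
  forall g, exists2 X, A g X & ~ is_zero X.

Definition universal_grading (G : groupType) (A : G -> C -> Prop) :=
  [/\ grading A, faithful_grading A & forall X, A 1%g X <-> ad X].

End FusionNotions.

Section InvertibleGroup.
Variables (K : closedFieldType) (C : fusionCategory K).
Implicit Types (X Y Z : C).

Lemma isomorphic_refl X : isomorphic X X.
Proof. by exists (idm X), (idm X); split; rewrite comp_idl. Qed.

Lemma isomorphic_sym X Y : isomorphic X Y -> isomorphic Y X.
Proof. by case=> f [g [gf fg]]; exists g, f; split. Qed.

Lemma isomorphic_trans Y X Z :
  isomorphic X Y -> isomorphic Y Z -> isomorphic X Z.
Proof.
case=> f [f' [f'f ff']] [g [g' [g'g gg']]]; exists (g \c f), (f' \c g'); split.
  by rewrite compA -(compA f') g'g comp_idr.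
by rewrite compA -(compA g) ff' comp_idr.
Qed.

Lemma isomorphic_ten X X' Y Y' : isomorphic X X' -> isomorphic Y Y' ->
  isomorphic (X \ox Y) (X' \ox Y').
Proof.
case=> f [f' [f'f ff']] [g [g' [g'g gg']]]; exists (f \om g), (f' \om g').
by split; rewrite -tenm_comp ?f'f ?g'g ?ff' ?gg' tenm_id.
Qed.

Lemma isomorphic_assoc X Y Z : isomorphic ((X \ox Y) \ox Z) (X \ox (Y \ox Z)).
Proof. by exists (assoc X Y Z), (assocV X Y Z); apply: assocK. Qed.

Lemma isomorphic_lunit X : isomorphic (one \ox X) X.
Proof. by exists (lunit X), (lunitV X); apply: lunitK. Qed.

Lemma isomorphic_runit X : isomorphic (X \ox one) X.
Proof. by exists (runit X), (runitV X); apply: runitK. Qed.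

Lemma ten_inverse X X' Y Y' :
  isomorphic (X \ox X') one -> isomorphic (Y \ox Y') one ->
  isomorphic ((X \ox Y) \ox (Y' \ox X')) one.
Proof.
move=> hX hY; apply: isomorphic_trans (isomorphic_assoc _ _ _) _.
apply: isomorphic_trans hX; apply: isomorphic_ten (isomorphic_refl _) _.
apply: isomorphic_trans (isomorphic_sym (isomorphic_assoc _ _ _)) _.
apply: isomorphic_trans (isomorphic_lunit _).
exact: isomorphic_ten (isomorphic_refl _).
Qed.

Lemma inverse_unique X X' Y Y' : isomorphic X Y ->
  isomorphic (X' \ox X) one -> isomorphic (Y \ox Y') one -> isomorphic X' Y'.
Proof.
move=> hXY hX hY; apply: isomorphic_trans (isomorphic_lunit Y').
apply: isomorphic_trans (isomorphic_sym (isomorphic_runit X')) _.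
apply: isomorphic_trans (isomorphic_ten (isomorphic_refl _)
  (isomorphic_sym hY)) _.
apply: isomorphic_trans (isomorphic_sym (isomorphic_assoc _ _ _)) _.
apply: isomorphic_ten (isomorphic_refl _).
apply: isomorphic_trans hX.
exact: isomorphic_ten (isomorphic_refl _) (isomorphic_sym hXY).
Qed.

Lemma invertible_one : invertible (one : C).
Proof. by exists one; split; apply: isomorphic_lunit. Qed.

Lemma invertible_ten X Y : invertible X -> invertible Y -> invertible (X \ox Y).
Proof.
by case=> X' [hX hX'] [Y' [hY hY']]; exists (Y' \ox X'); split;
  apply: ten_inverse.
Qed.

Definition iso_class X : C -> Prop := fun Y => isomorphic Y X.

Lemma iso_class_eq X Y : isomorphic X Y -> iso_class X = iso_class Y.
Proof.
move=> h; apply/funext => Z; apply/propext; split => hZ.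
  exact: isomorphic_trans h.
exact: isomorphic_trans (isomorphic_sym h).
Qed.

(* The group of isomorphism classes of invertible objects.                    *)
Record invgroup := InvGroup {
  invcl :> C -> Prop;
  invclP : exists2 X, invertible X & invcl = iso_class X
}.

HB.instance Definition _ := gen_eqMixin invgroup.
HB.instance Definition _ := gen_choiceMixin invgroup.

Lemma invcl_inj (c d : invgroup) : invcl c = invcl d -> c = d.
Proof.
by case: c d => [c cP] [d dP] /= cd; case: d / cd dP => dP;
  rewrite (Prop_irrelevance cP dP).
Qed.

Fact invcl_one_subproof : exists2 X, invertible X & iso_class one = iso_class X.
Proof. by exists one => //; apply: invertible_one. Qed.
Definition invcl_one := InvGroup invcl_one_subproof.

Definition mulcl (c d : C -> Prop) : C -> Prop := fun Z =>
  exists X Y, [/\ c X, d Y & isomorphic Z (X \ox Y)].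

Lemma mulclE X Y :
  mulcl (iso_class X) (iso_class Y) = iso_class (X \ox Y).
Proof.
apply/funext => Z; apply/propext; split=> [[X' [Y' [hX hY hZ]]]|hZ].
  exact: isomorphic_trans hZ (isomorphic_ten hX hY).
by exists X, Y; split=> //; apply: isomorphic_refl.
Qed.

Fact invcl_mul_subproof (c d : invgroup) :
  exists2 X, invertible X & mulcl c d = iso_class X.
Proof.
case: c d => [c [X iX cX]] [d [Y iY dY]] /=; exists (X \ox Y).
  exact: invertible_ten.
by rewrite cX dY mulclE.
Qed.
Definition invcl_mul c d := InvGroup (invcl_mul_subproof c d).

Definition invcls (c : C -> Prop) : C -> Prop := fun Y =>
  exists2 X, c X & isomorphic (X \ox Y) one /\ isomorphic (Y \ox X) one.

Lemma invclsE X Y : isomorphic (X \ox Y) one -> isomorphic (Y \ox X) one ->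
  invcls (iso_class X) = iso_class Y.
Proof.
move=> hXY hYX; apply/funext => Z; apply/propext; split.
  by case=> X' hX [_ h]; apply: inverse_unique hX h hXY.
move=> hZ; exists X; first exact: isomorphic_refl.
split; [apply: isomorphic_trans hXY | apply: isomorphic_trans hYX].
  exact: isomorphic_ten (isomorphic_refl _) hZ.
exact: isomorphic_ten hZ (isomorphic_refl _).
Qed.

Fact invcl_inv_subproof (c : invgroup) :
  exists2 X, invertible X & invcls c = iso_class X.
Proof.
case: c => [c [X [Y [hXY hYX]] cX]] /=; exists Y; first by exists X.
by rewrite cX (invclsE hXY hYX).
Qed.
Definition invcl_inv c := InvGroup (invcl_inv_subproof c).

Fact invcl_mulA : associative invcl_mul.
Proof.
move=> [c [X iX cX]] [d [Y iY dY]] [e [Z iZ eZ]]; apply: invcl_inj => /=.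
rewrite cX dY eZ !mulclE; apply/iso_class_eq/isomorphic_sym.
exact: isomorphic_assoc.
Qed.

Fact invcl_mul1 : left_id invcl_one invcl_mul.
Proof.
move=> [c [X iX cX]]; apply: invcl_inj => /=.
by rewrite cX mulclE; apply/iso_class_eq/isomorphic_lunit.
Qed.

Fact invcl_mulr1 : right_id invcl_one invcl_mul.
Proof.
move=> [c [X iX cX]]; apply: invcl_inj => /=.
by rewrite cX mulclE; apply/iso_class_eq/isomorphic_runit.
Qed.

Fact invcl_mulV : left_inverse invcl_one invcl_inv invcl_mul.
Proof.
move=> [c [X [Y [hXY hYX]] cX]]; apply: invcl_inj => /=.
by rewrite cX (invclsE hXY hYX) mulclE; apply/iso_class_eq.
Qed.

Fact invcl_mulrV : right_inverse invcl_one invcl_inv invcl_mul.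
Proof.
move=> [c [X [Y [hXY hYX]] cX]]; apply: invcl_inj => /=.
by rewrite cX (invclsE hXY hYX) mulclE; apply/iso_class_eq.
Qed.

HB.instance Definition _ := isGroup.Build invgroup
  invcl_mulA invcl_mul1 invcl_mulr1 invcl_mulV invcl_mulrV.

End InvertibleGroup.

Record braidedFusionCategory (K : closedFieldType) := BraidedFusionCategory {
  bcat :> fusionCategory K;
  braid : forall X Y : bcat, hom (X \ox Y) (Y \ox X);
  braid_iso : forall X Y, is_iso (braid X Y);
  braid_nat : forall X X' Y Y' (f : hom X X') (g : hom Y Y'),
    braid X' Y' \c (f \om g) = (g \om f) \c braid X Y;
  hexagon : forall X Y Z,
    assoc Y Z X \c braid X (Y \ox Z) \c assoc X Y Z =
    (idm Y \om braid X Z) \c assoc Y X Z \c (braid X Y \om idm Z);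
  hexagonV : forall X Y Z,
    assocV Z X Y \c braid (X \ox Y) Z \c assocV X Y Z =
    (braid X Z \om idm Y) \c assocV X Z Y \c (idm X \om braid Y Z)
}.

Arguments braid {K b} X Y : rename.

Section Spherical.
Variables (K : closedFieldType) (C : fusionCategory K).

(* A pivotal structure is a monoidal natural isomorphism X -> X^**.           *)
Record pivotal (piv : forall X : C, hom X (dual (dual X))) : Prop := Pivotal {
  piv_iso : forall X, is_iso (piv X);
  piv_nat : forall X Y (f : hom X Y),
    piv Y \c f = dualm (dualm f) \c piv X;
  piv_ten : forall X Y,
    dualm (dual_ten X Y) \c piv (X \ox Y) =
    dual_ten (dual Y) (dual X) \c (piv X \om piv Y)
}.

Variable piv : forall X : C, hom X (dual (dual X)).

(* The coordinate of an endomorphism of the unit object on the basis (id).    *)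
Definition scalar (f : hom (one : C) one) : K :=
  coord [tuple idm (one : C)] ord0 f.

Definition tr (X : C) (f : hom X X) : K :=
  scalar (ev (dual X) \c ((piv X \c f) \om idm (dual X)) \c coev X).

Definition qdim (X : C) : K := tr (idm X).

Definition spherical := pivotal piv /\ forall X, qdim X = qdim (dual X).

End Spherical.

Definition Smatrix (K : closedFieldType) (C : braidedFusionCategory K)
    (piv : forall X : C, hom X (dual (dual X))) : 'M[K]_(rank C) :=
  \matrix_(i, j)
    tr piv (braid (irr C j) (irr C i) \c braid (irr C i) (irr C j)).

Record modularCategory (K : closedFieldType) := ModularCategory {
  modcat :> braidedFusionCategory K;
  piv : forall X : modcat, hom X (dual (dual X));
  pivP : spherical piv;
  SmatrixP : Smatrix piv \in unitmx
}.

(* Main.v *)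
Require Import Defs.
From HB Require Import structures.
From mathcomp Require Import all_boot all_order all_algebra all_field.
From mathcomp Require Import all_fingroup all_solvable.
From mathcomp Require Import boolp.
(* Imported again so that hom and rank denote those of categories. *)
Import Defs.

(** The invertible simple objects form a group of order p ^ k, and it acts by
    tensoring on the simple objects of A g, since pt C is contained in
    ad C = A 1.  As this is a p-group, the rank of A g is congruent modulo p to
    the number of fixed points, so it suffices that A g has none when g <> 1
    (fixed_grade).

    For h invertible and X simple, h (x) X is simple, so the double braiding
    of h with X is a scalar b(h, X), written braids_by h X (b(h, X)).  The
    hexagons make b multiplicative in both arguments.  Hence
    b(h, dual X) = 1 / b(h, X), b(h, -) is 1 on ad C, and b(h, X) depends only
    on the degree of X (braids_by_grade).

    Suppose that X is fixed by every h.

    - b(h, X) ^ 2 = 1 (fixed_braids_by_sq).  An isomorphism phi : h (x) X -> X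
      yields a nonzero i : h -> X (x) dual X, namely phi composed with the
      coevaluation.  The double braiding D of X with dual X multiplies the
      coevaluation by some scalar m; moving h across D on the side of X shows
      that D i = b(h, dual X) m i, while writing i through a map from
      dual X (x) h to dual X and moving h across on that side shows that D i = b(h, X) m i.  So b(h, X) is its own inverse.
    - The group has odd order, so h is a square k (x) k, and
      b(h, X) = b(k, X) ^ 2 = 1.

    It remains to see that only objects of degree 1 have b(h, X) = 1 for all h
    (centralizer_pt_grade); this is where modularity enters.  The quantum
    dimension is multiplicative (qdim_ten), hence for h invertible and Y
    simple the entry of the S-matrix is qdim h * b(h, Y) * qdim Y.  The rows
    of S indexed by invertible objects therefore factor through the square
    matrix (qdim h * b(h, c)), with c ranging over the degrees.  If b(h, c) = 1
    for all h and some c <> 1, its columns c and 1 coincide, it kills a nonzero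
    row vector, and so does S, contrary to its invertibility.

    Computations in a category that is not strict are made tractable by
    replacing a pairing A (x) B -> 1 with the natural family
    A (x) (B (x) W) -> W (pairfam), and dually (copairfam).  In terms of these
    families the zigzag identities and the formulas for mates involve no
    associator, and whiskering on the right is a mere change of W. *)

Set Implicit Arguments.
Unset Strict Implicit.
Unset Printing Implicit Defensive.

Import Order.TTheory GRing.Theory Num.Theory.
Local Open Scope ring_scope.
Local Open Scope cat_scope.

(** * Composition in linear categories *)

Section Linear.
Variables (K : closedFieldType) (C : linearCategory K).
Implicit Types X Y Z W : C.

Lemma comp0l X Y Z (f : hom X Y) : (0 : hom Y Z) \c f = 0.
Proof. by have := comp_linl (-1) 0 (0 : hom Y Z) f; rewrite scaler0 addr0 scaleN1r addNr. Qed.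

Lemma comp0r X Y Z (g : hom Y Z) : g \c (0 : hom X Y) = 0.
Proof. by have := comp_linr (-1) g 0 (0 : hom X Y); rewrite scaler0 addr0 scaleN1r addNr. Qed.

Lemma compZl X Y Z a (g : hom Y Z) (f : hom X Y) : (a *: g) \c f = a *: (g \c f).
Proof. by have := comp_linl a g 0 f; rewrite comp0l !addr0. Qed.

Lemma compZr X Y Z a (g : hom Y Z) (f : hom X Y) : g \c (a *: f) = a *: (g \c f).
Proof. by have := comp_linr a g f 0; rewrite comp0r !addr0. Qed.

Lemma compDl X Y Z (g g' : hom Y Z) (f : hom X Y) : (g + g') \c f = (g \c f) + (g' \c f).
Proof. by have := comp_linl 1 g g' f; rewrite !scale1r. Qed.

Lemma compDr X Y Z (g : hom Y Z) (f f' : hom X Y) : g \c (f + f') = (g \c f) + (g \c f').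
Proof. by have := comp_linr 1 g f f'; rewrite !scale1r. Qed.

Lemma compBr X Y Z (g : hom Y Z) (f f' : hom X Y) : g \c (f - f') = (g \c f) - (g \c f').
Proof. by rewrite addrC -scaleN1r comp_linr scaleN1r addrC. Qed.

Lemma compBl X Y Z (g g' : hom Y Z) (f : hom X Y) : (g - g') \c f = (g \c f) - (g' \c f).
Proof. by rewrite addrC -scaleN1r comp_linl scaleN1r addrC. Qed.

Lemma comp_suml X Y Z n (g : 'I_n -> hom Y Z) (f : hom X Y) :
  (\sum_i g i) \c f = \sum_i (g i \c f).
Proof. by apply: (big_morph (fun x => x \c f)) => [x y|]; rewrite ?compDl ?comp0l. Qed.

Lemma comp_sumr X Y Z n (g : hom Y Z) (f : 'I_n -> hom X Y) :
  g \c (\sum_i f i) = \sum_i (g \c f i).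
Proof. by apply: (big_morph (comp g)) => [x y|]; rewrite ?compDr ?comp0r. Qed.

Lemma comp_isoIl X Y Z (f : hom Y Z) (g h : hom X Y) :
  is_iso f -> f \c g = f \c h -> g = h.
Proof.
by case=> f' [f'f _] e; rewrite -(comp_idl g) -(comp_idl h) -f'f -!compA e.
Qed.

Lemma comp_isoIr X Y Z (f : hom X Y) (g h : hom Y Z) :
  is_iso f -> g \c f = h \c f -> g = h.
Proof.
by case=> f' [_ ff'] e; rewrite -(comp_idr g) -(comp_idr h) -ff' !compA e.
Qed.

Lemma is_iso_comp X Y Z (g : hom Y Z) (f : hom X Y) :
  is_iso g -> is_iso f -> is_iso (g \c f).
Proof.
case=> g' [g'g gg'] [f' [f'f ff']]; exists (f' \c g'); split.
  by rewrite compA -(compA f') g'g comp_idr.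
by rewrite compA -(compA g) ff' comp_idr.
Qed.

Lemma inverses_iso X Y (f : hom X Y) (g : hom Y X) : inverses f g -> is_iso f.
Proof. by exists g. Qed.

Lemma inverses_sym X Y (f : hom X Y) (g : hom Y X) : inverses f g -> inverses g f.
Proof. by case. Qed.

Lemma zero_homr X Y (f : hom X Y) : is_zero Y -> f = 0.
Proof. by move=> z; rewrite -(comp_idl f) z comp0l. Qed.

Lemma iso_zero X Y : isomorphic X Y -> is_zero Y -> is_zero X.
Proof. by case=> f [g [gf _]] zY; rewrite /is_zero -gf (zero_homr f zY) comp0r. Qed.

End Linear.

(** * Coherence, and families attached to pairings *)

Section Monoidal.
Variables (K : closedFieldType) (C : monoidalCategory K).
Implicit Types X Y Z W A B : C.

Lemma tenm0l X X' Y Y' (g : hom Y Y') : (0 : hom X X') \om g = 0.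
Proof. by have := tenm_linl (-1) 0 (0 : hom X X') g; rewrite scaler0 addr0 scaleN1r addNr. Qed.

Lemma tenm0r X X' Y Y' (f : hom X X') : f \om (0 : hom Y Y') = 0.
Proof. by have := tenm_linr (-1) f 0 (0 : hom Y Y'); rewrite scaler0 addr0 scaleN1r addNr. Qed.

Lemma tenmZl X X' Y Y' a (f : hom X X') (g : hom Y Y') :
  (a *: f) \om g = a *: (f \om g).
Proof. by have := tenm_linl a f 0 g; rewrite tenm0l !addr0. Qed.

Lemma tenmZr X X' Y Y' a (f : hom X X') (g : hom Y Y') :
  f \om (a *: g) = a *: (f \om g).
Proof. by have := tenm_linr a f g 0; rewrite tenm0r !addr0. Qed.

Lemma tenmBr X X' Y Y' (f : hom X X') (g g' : hom Y Y') :
  f \om (g - g') = f \om g - f \om g'.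
Proof. by rewrite addrC -scaleN1r tenm_linr scaleN1r addrC. Qed.

Lemma tenmDl X X' Y Y' (f f' : hom X X') (g : hom Y Y') :
  (f + f') \om g = f \om g + f' \om g.
Proof. by have := tenm_linl 1 f f' g; rewrite !scale1r. Qed.

Lemma tenmDr X X' Y Y' (f : hom X X') (g g' : hom Y Y') :
  f \om (g + g') = f \om g + f \om g'.
Proof. by have := tenm_linr 1 f g g'; rewrite !scale1r. Qed.

Lemma tenm_suml X X' Y Y' n (f : 'I_n -> hom X X') (g : hom Y Y') :
  (\sum_i f i) \om g = \sum_i (f i \om g).
Proof. by apply: (big_morph (fun x => x \om g)) => [x y|]; rewrite ?tenmDl ?tenm0l. Qed.

Lemma tenm_sumr X X' Y Y' n (f : hom X X') (g : 'I_n -> hom Y Y') :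
  f \om (\sum_i g i) = \sum_i (f \om g i).
Proof. by apply: (big_morph (tenm f)) => [x y|]; rewrite ?tenmDr ?tenm0r. Qed.

Lemma tenm_compl X X' X'' Y (f' : hom X' X'') (f : hom X X') :
  (f' \c f) \om idm Y = (f' \om idm Y) \c (f \om idm Y).
Proof. by rewrite -tenm_comp comp_idl. Qed.

Lemma tenm_compr X Y Y' Y'' (g' : hom Y' Y'') (g : hom Y Y') :
  idm X \om (g' \c g) = (idm X \om g') \c (idm X \om g).
Proof. by rewrite -tenm_comp comp_idl. Qed.

Lemma tenm_exch X X' Y Y' (f : hom X X') (g : hom Y Y') :
  (idm X' \om g) \c (f \om idm Y) = (f \om idm Y') \c (idm X \om g).
Proof. by rewrite -!tenm_comp !comp_idl !comp_idr. Qed.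

Lemma tenm_iso X X' Y Y' (f : hom X X') (g : hom Y Y') :
  is_iso f -> is_iso g -> is_iso (f \om g).
Proof.
case=> f' [f'f ff'] [g' [g'g gg']]; exists (f' \om g').
by split; rewrite -tenm_comp ?f'f ?g'g ?ff' ?gg' tenm_id.
Qed.

Lemma is_iso_id X : is_iso (idm X).
Proof. by exists (idm X); split; rewrite comp_idl. Qed.

Lemma assocVassoc X Y Z : assocV X Y Z \c assoc X Y Z = idm _.
Proof. by case: (assocK X Y Z). Qed.
Lemma assocassocV X Y Z : assoc X Y Z \c assocV X Y Z = idm _.
Proof. by case: (assocK X Y Z). Qed.
Lemma assoc_iso X Y Z : is_iso (assoc X Y Z).
Proof. exact: inverses_iso (assocK X Y Z). Qed.
Lemma assocV_iso X Y Z : is_iso (assocV X Y Z).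
Proof. exact: inverses_iso (inverses_sym (assocK X Y Z)). Qed.
Lemma lunitlunitV X : lunit X \c lunitV X = idm _.
Proof. by case: (lunitK X). Qed.
Lemma runitVrunit X : runitV X \c runit X = idm _.
Proof. by case: (runitK X). Qed.
Lemma lunit_iso X : is_iso (lunit X).
Proof. exact: inverses_iso (lunitK X). Qed.
Lemma lunitV_iso X : is_iso (lunitV X).
Proof. exact: inverses_iso (inverses_sym (lunitK X)). Qed.
Lemma runit_iso X : is_iso (runit X).
Proof. exact: inverses_iso (runitK X). Qed.
Lemma runitV_iso X : is_iso (runitV X).
Proof. exact: inverses_iso (inverses_sym (runitK X)). Qed.

Lemma assocV_nat X X' Y Y' Z Z' (f : hom X X') (g : hom Y Y') (h : hom Z Z') :
  assocV X' Y' Z' \c (f \om (g \om h)) = ((f \om g) \om h) \c assocV X Y Z.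
Proof.
apply: (comp_isoIl (assoc_iso X' Y' Z')).
by rewrite !compA assocassocV comp_idl assoc_nat -compA assocassocV comp_idr.
Qed.

Lemma lunitV_nat X Y (f : hom X Y) : lunitV Y \c f = (idm one \om f) \c lunitV X.
Proof.
apply: (comp_isoIl (lunit_iso Y)).
by rewrite !compA lunitlunitV comp_idl lunit_nat -compA lunitlunitV comp_idr.
Qed.

Lemma ten1_inj X Y (f g : hom X Y) : idm one \om f = idm one \om g -> f = g.
Proof.
move=> e; apply: (comp_isoIr (lunit_iso X)).
by rewrite -!lunit_nat e.
Qed.

Lemma tenr1_inj X Y (f g : hom X Y) : f \om idm one = g \om idm one -> f = g.
Proof.
move=> e; apply: (comp_isoIr (runit_iso X)).
by rewrite -!runit_nat e.
Qed.

(** Kelly's coherence: it suffices to check the equation after tensoring by the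
    unit on the left, where it follows from the pentagon on 1, 1, X, Y and two
    triangles. *)
Lemma lunit_ten X Y : lunit (X \ox Y) \c assoc one X Y = lunit X \om idm Y.
Proof.
apply: ten1_inj.
apply: (@comp_isoIr _ _ _ _ _ (assoc one (one \ox X) Y \c (assoc one one X \om idm Y))).
  apply: is_iso_comp; first exact: assoc_iso.
  by apply: tenm_iso; [apply: assoc_iso | apply: is_iso_id].
rewrite tenm_compr -compA (compA (idm one \om assoc _ _ _)) -pentagon.
rewrite compA triangle compA -assoc_nat -compA -tenm_compl triangle.
by rewrite -(tenm_id X Y) assoc_nat.
Qed.

Lemma lunitV_ten X Y : assocV one X Y \c lunitV (X \ox Y) = lunitV X \om idm Y.
Proof.
have := tenm_iso (lunit_iso X) (is_iso_id Y) => i; apply: (comp_isoIl i).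
rewrite -[in LHS]lunit_ten -tenm_comp lunitlunitV comp_idl tenm_id.
by rewrite !compA -(compA (lunit _)) assocassocV comp_idr lunitlunitV.
Qed.

Lemma pentagon_moved W X Y Z :
  (idm W \om assocV X Y Z) \c assoc W X (Y \ox Z) \c assoc (W \ox X) Y Z =
  assoc W (X \ox Y) Z \c (assoc W X Y \om idm Z).
Proof.
rewrite -compA pentagon !compA -tenm_compr assocVassoc tenm_id comp_idl //.
Qed.

Lemma pentagonV W X Y Z :
  assocV (W \ox X) Y Z \c assocV W X (Y \ox Z) =
  (assocV W X Y \om idm Z) \c assocV W (X \ox Y) Z \c (idm W \om assocV X Y Z).
Proof.
apply: (comp_isoIl (is_iso_comp (assoc_iso W X (Y \ox Z)) (assoc_iso (W \ox X) Y Z))).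
rewrite {2}pentagon.
rewrite -[LHS]compA (compA (assoc (W \ox X) Y Z)) assocassocV comp_idl assocassocV.
rewrite -!compA (compA (assoc W X Y \om _)) -tenm_compl assocassocV tenm_id comp_idl.
rewrite (compA (assoc W _ _)) assocassocV comp_idl -tenm_compr assocassocV tenm_id //.
Qed.

(** The pairing e whiskered by W on the right, with the structural isomorphisms
    absorbed.  Locked, so that the families stay atomic under rewriting by the
    laws of composition. *)
Definition pairfam A B (e : hom (A \ox B) one) W : hom (A \ox (B \ox W)) W :=
  locked (lunit W \c (e \om idm W) \c assocV A B W).

Definition copairfam A B (c : hom one (A \ox B)) W : hom W (A \ox (B \ox W)) :=
  locked (assoc A B W \c (c \om idm W) \c lunitV W).

Lemma pairfamE A B (e : hom (A \ox B) one) W :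
  pairfam e W = lunit W \c (e \om idm W) \c assocV A B W.
Proof. by rewrite /pairfam -lock. Qed.

Lemma copairfamE A B (c : hom one (A \ox B)) W :
  copairfam c W = assoc A B W \c (c \om idm W) \c lunitV W.
Proof. by rewrite /copairfam -lock. Qed.

Lemma pairfam_nat A B (e : hom (A \ox B) one) W W' (f : hom W W') :
  f \c pairfam e W = pairfam e W' \c (idm A \om (idm B \om f)).
Proof.
rewrite !pairfamE -!compA assocV_nat tenm_id !compA -lunit_nat; congr (_ \c _).
by rewrite -!compA tenm_exch.
Qed.

Lemma copairfam_nat A B (c : hom one (A \ox B)) W W' (f : hom W W') :
  copairfam c W' \c f = (idm A \om (idm B \om f)) \c copairfam c W.
Proof.
rewrite !copairfamE -!compA lunitV_nat !compA -assoc_nat tenm_id; congr (_ \c _).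
by rewrite -!compA tenm_exch.
Qed.

Lemma pairfam_comp A A' B B' (e : hom (A' \ox B') one) (f : hom A A') (g : hom B B') W :
  pairfam (e \c (f \om g)) W = pairfam e W \c (f \om (g \om idm W)).
Proof. by rewrite !pairfamE tenm_compl -!compA assocV_nat. Qed.

Lemma copairfam_comp A A' B B' (c : hom one (A \ox B)) (f : hom A A') (g : hom B B') W :
  copairfam ((f \om g) \c c) W = (f \om (g \om idm W)) \c copairfam c W.
Proof. by rewrite !copairfamE tenm_compl !compA assoc_nat. Qed.

(** The families are morphisms of right module functors: on a product V (x) W
    they are determined by their values on V. *)
Lemma pairfam_ten A B (e : hom (A \ox B) one) V W :
  pairfam e V \om idm W =
    pairfam e (V \ox W) \c (idm A \om assoc B V W) \c assoc A (B \ox V) W.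
Proof.
apply: (comp_isoIr (is_iso_comp (assocV_iso A (B \ox V) W)
  (tenm_iso (is_iso_id A) (assocV_iso B V W)))).
rewrite !compA -(compA _ (assoc _ _ _)) assocassocV comp_idr.
rewrite -(compA _ (idm A \om assoc _ _ _)) -tenm_compr assocassocV tenm_id comp_idr.
rewrite !pairfamE !tenm_compl -2!compA (compA (assocV _ _ _ \om _)) -pentagonV.
rewrite -(lunit_ten V W) -[idm (V \ox W)]tenm_id.
rewrite -!compA; congr (_ \c _); rewrite !compA; congr (_ \c _).
by rewrite -(compA (assoc one V W)) -assocV_nat compA assocassocV comp_idl.
Qed.

(** Whiskering the mate of a pairing and a copairing gives a composite of
    families without associators; one of the two zigzags has this form. *)
Lemma mate_ten A B D (e : hom (A \ox B) one) (c : hom one (B \ox D)) W :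
  (lunit D \c (e \om idm D) \c assocV A B D \c (idm A \om c) \c runitV A) \om idm W
  = pairfam e (D \ox W) \c (idm A \om copairfam c W).
Proof.
rewrite -pairfamE 2!tenm_compl pairfam_ten.
rewrite !copairfamE !tenm_compr -!compA; congr (_ \c _); congr (_ \c _).
rewrite !compA assoc_nat -!compA; congr (_ \c _).
apply: (comp_isoIr (tenm_iso (runit_iso A) (is_iso_id W))).
rewrite -!compA -tenm_compl runitVrunit tenm_id comp_idr.
apply: (comp_isoIl (tenm_iso (is_iso_id A) (lunit_iso W))).
by rewrite !compA -tenm_compr lunitlunitV tenm_id comp_idl triangle.
Qed.

(** The mirror image of the preceding lemma, which covers the other zigzag. *)
Lemma comate_ten X Z X' (e : hom (Z \ox X') one) (f : hom one (X \ox Z)) A :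
  (runit X \c (idm X \om e) \c assoc X Z X' \c (f \om idm X') \c lunitV X') \om idm A
  = (idm X \om pairfam e A) \c copairfam f (X' \ox A).
Proof.
rewrite pairfamE copairfamE !tenm_compr !tenm_compl.
rewrite -triangle -!compA; congr (_ \c _).
rewrite (compA (assoc X one A)) assoc_nat -!compA; congr (_ \c _).
rewrite -lunitV_ten (compA _ (assocV _ _ _)) -[idm (X' \ox A)]tenm_id -assocV_nat.
rewrite !compA; congr (_ \c _); congr (_ \c _).
apply: (comp_isoIr (assoc_iso (X \ox Z) X' A)).
by rewrite pentagon_moved -compA assocVassoc comp_idr.
Qed.

Lemma copairfam_inj A B (e e' : hom one (A \ox B)) :
  (forall W, copairfam e W = copairfam e' W) -> e = e'.
Proof.
move/(_ one); rewrite !copairfamE => /(comp_isoIr (lunitV_iso _)).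
by move/(comp_isoIl (assoc_iso _ _ _))/tenr1_inj.
Qed.

(** In the families, a closed loop becomes multiplication by its value. *)
Lemma pairfam_copairfam A B (e : hom (A \ox B) one) (c : hom one (A \ox B)) a W :
  e \c c = a *: idm one -> pairfam e W \c copairfam c W = a *: idm W.
Proof.
move=> ec; rewrite pairfamE copairfamE !compA -(compA _ (assocV _ _ _)) assocVassoc comp_idr.
by rewrite -(compA _ (e \om _)) -tenm_compl ec tenmZl tenm_id compZr comp_idr compZl lunitlunitV.
Qed.

(** The family of a nested pairing is the composite of the two families: this
    strictifies the evaluation of a product. *)
Lemma pairfam_nest A B X Y (e : hom (A \ox X) one) (e' : hom (B \ox Y) one) W :
  pairfam (e' \c (idm B \om pairfam e Y) \c assoc B A (X \ox Y)) W
    \c (idm (B \ox A) \om assocV X Y W) \c assocV B A (X \ox (Y \ox W))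
  = pairfam e' W \c (idm B \om pairfam e (Y \ox W)).
Proof.
apply: (comp_isoIr (assoc_iso B A (X \ox (Y \ox W)))).
rewrite -[LHS]compA assocVassoc comp_idr.
apply: (comp_isoIr (tenm_iso (is_iso_id (B \ox A)) (assoc_iso X Y W))).
rewrite -[LHS]compA -tenm_compr assocVassoc tenm_id comp_idr.
apply: (comp_isoIr (assoc_iso (B \ox A) (X \ox Y) W)).
rewrite pairfamE -[LHS]compA assocVassoc comp_idr !tenm_compl.
rewrite -!compA -(tenm_id B A) (compA (assoc B A _)) assoc_nat -!compA pentagon.
rewrite !compA -(compA (pairfam e' W)) -tenm_compr -(compA (pairfam e' W)) -tenm_compr.
rewrite -pairfam_ten.
rewrite -!compA (compA _ (assoc _ _ _)) -assoc_nat (pairfamE e').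
by rewrite !compA -(compA _ (assocV _ _ _)) assocVassoc comp_idr.
Qed.

End Monoidal.

(** * Zigzag identities *)

Section Duals.
Variables (K : closedFieldType) (C : fusionCategory K).
Implicit Types X Y Z W A B : C.

Lemma zigzag X W :
  (idm X \om pairfam (ev X) W) \c copairfam (coev X) (X \ox W) = idm (X \ox W).
Proof. by rewrite -comate_ten; case: (dualP X) => -> _; rewrite tenm_id. Qed.

Lemma zigzag_dual X W :
  pairfam (ev X) (dual X \ox W) \c (idm (dual X) \om copairfam (coev X) W) =
  idm (dual X \ox W).
Proof. by rewrite -mate_ten; case: (dualP X) => _ ->; rewrite tenm_id. Qed.

(** A pairing is recovered from its mate by evaluation, which characterises the
    mate; dualm and dual_ten are computed through this. *)
Lemma ev_mate A B (e : hom (A \ox B) one) W :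
  pairfam (ev B) W \c (mate e \om idm (B \ox W)) = pairfam e W.
Proof.
rewrite /mate mate_ten compA pairfam_nat -compA -tenm_compr zigzag tenm_id comp_idr //.
Qed.

Lemma ev_dualm X Y (f : hom X Y) W :
  pairfam (ev X) W \c (dualm f \om idm (X \ox W)) =
  pairfam (ev Y) W \c (idm (dual Y) \om (f \om idm W)).
Proof. by rewrite ev_mate pairfam_comp. Qed.

Lemma ev_tenE X Y : ev_ten X Y =
  ev Y \c (idm (dual Y) \om pairfam (ev X) Y) \c assoc (dual Y) (dual X) (X \ox Y).
Proof. by rewrite pairfamE. Qed.

Lemma ev_dual_ten X Y W :
  pairfam (ev (X \ox Y)) W \c (dual_ten X Y \om assocV X Y W)
    \c assocV (dual Y) (dual X) (X \ox (Y \ox W))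
  = pairfam (ev Y) W \c (idm (dual Y) \om pairfam (ev X) (Y \ox W)).
Proof.
rewrite -pairfam_nest -ev_tenE -(ev_mate (ev_ten X Y)).
rewrite -!compA; congr (_ \c _); rewrite compA; congr (_ \c _).
by rewrite -tenm_comp comp_idl comp_idr.
Qed.

(** Under the canonical isomorphism with dual Y (x) dual X, the nested
    coevaluation is the coevaluation of X (x) Y, because a coevaluation is
    determined by the evaluation through the zigzag identities. *)
Lemma coev_dual_ten X Y A :
  (idm X \om (idm Y \om ((dual_ten X Y \om idm A) \c assocV (dual Y) (dual X) A)))
    \c (idm X \om copairfam (coev Y) (dual X \ox A)) \c copairfam (coev X) A
  = assoc X Y _ \c copairfam (coev (X \ox Y)) A.
Proof.
set P := dual (X \ox Y).
(* d inserts the canonical isomorphism; the zigzag of X (x) Y rewrites it through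
   the evaluations, after which the zigzags of X and of Y apply. *)
pose d B := (dual_ten X Y \om idm B) \c assocV (dual Y) (dual X) B.
have dn B B' (f : hom B B') :
    (idm P \om f) \c d B = d B' \c (idm (dual Y) \om (idm (dual X) \om f)).
  by rewrite /d -compA assocV_nat tenm_id !compA tenm_exch.
rewrite -/(d A).
have -> : d A = pairfam (ev (X \ox Y)) (P \ox A) \c d ((X \ox Y) \ox (P \ox A))
    \c (idm (dual Y) \om (idm (dual X) \om copairfam (coev (X \ox Y)) A)).
  by rewrite -compA -dn compA zigzag_dual comp_idl.
have -> : pairfam (ev (X \ox Y)) (P \ox A) \c d ((X \ox Y) \ox (P \ox A)) =
    pairfam (ev Y) (P \ox A) \c (idm (dual Y) \om (pairfam (ev X) (Y \ox (P \ox A))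
      \c (idm (dual X) \om assoc X Y (P \ox A)))).
  rewrite tenm_compr compA -ev_dual_ten -!compA assocV_nat tenm_id; congr (_ \c _).
  by rewrite !compA -tenm_comp assocVassoc comp_idr.
set g := assoc X Y (P \ox A) \c copairfam (coev (X \ox Y)) A.
rewrite -[pairfam (ev Y) _ \c _ \c _]compA -[(idm (dual Y) \om _) \c (idm (dual Y) \om _)]tenm_compr.
rewrite -[pairfam (ev X) _ \c _ \c _]compA -[(idm (dual X) \om _) \c (idm (dual X) \om _)]tenm_compr.
rewrite -/g -tenm_compr (tenm_compr Y) -compA -copairfam_nat compA zigzag comp_idl.
by rewrite tenm_compr -compA -copairfam_nat compA zigzag comp_idl.
Qed.

End Duals.

(** * Multiplicativity of the quantum dimension *)

Section Trace.
Variables (K : closedFieldType) (C : fusionCategory K).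
Variable piv : forall X : C, hom X (dual (dual X)).
Hypothesis pivP : pivotal piv.
Implicit Types X Y Z W A B : C.

(** The right evaluation that the pivotal structure provides; the dimension of X
    is the loop that it closes with coev X. *)
Definition pivev X : hom (X \ox dual X) one := ev (dual X) \c (piv X \om idm (dual X)).

Lemma pairfam_pivev X W :
  pairfam (pivev X) W = pairfam (ev (dual X)) W \c (piv X \om idm _).
Proof. by rewrite pairfam_comp tenm_id. Qed.

(** Monoidality of the pivotal structure makes the right evaluation of a product
    nested. *)
Lemma pivev_ten X Y W :
  pairfam (pivev (X \ox Y)) W \c (idm (X \ox Y) \om ((dual_ten X Y \om idm W) \c assocV _ _ W))
    \c assocV X Y (dual Y \ox (dual X \ox W))
  = pairfam (pivev X) W \c (idm X \om pairfam (pivev Y) (dual X \ox W)).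
Proof.
rewrite pairfam_pivev tenm_compr -!compA (compA (piv _ \om _)) -tenm_exch.
rewrite !compA -ev_dualm -!compA (compA (dualm _ \om _)) -tenm_compl.
case: pivP => _ _ ->; rewrite tenm_compl -!compA.
rewrite (compA _ (idm _ \om assocV _ _ _)) -tenm_exch -!compA -(tenm_id _ (dual X \ox W)) -assocV_nat.
rewrite tenm_id (compA (dual_ten _ _ \om _)) -tenm_comp comp_idl comp_idr !compA.
rewrite ev_dual_ten !pairfam_pivev -!compA tenm_compr !compA.
by rewrite -!compA -!tenm_comp !comp_idl !comp_idr.
Qed.

Hypothesis one_scalar : forall f : hom (one : C) one, exists a, f = a *: idm one.

Lemma scalarE a : scalar (a *: idm (one : C)) = a.
Proof.
have fr : free [tuple idm (one : C)].
  by rewrite seq1_free; apply/eqP; case: (one_simple C).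
by have /= := coord_free ord0 ord0 fr; rewrite /scalar linearZ /= => ->; rewrite mulr1.
Qed.

Lemma pivev_coev X : pivev X \c coev X = qdim piv X *: idm one.
Proof.
rewrite /qdim /tr comp_idr /pivev.
by case: (one_scalar (ev (dual X) \c (piv X \om idm (dual X)) \c coev X)) => a ->; rewrite scalarE.
Qed.

(** Both the coevaluation and the right evaluation of X (x) Y are nested, so the
    loop of Y can be evaluated inside that of X. *)
Lemma qdim_ten X Y : qdim piv (X \ox Y) = qdim piv X * qdim piv Y.
Proof.
have e Z W := @pairfam_copairfam _ _ _ _ _ _ _ W (pivev_coev Z).
suff : qdim piv (X \ox Y) *: idm (one : C) = (qdim piv X * qdim piv Y) *: idm one.
  by move/(congr1 (@scalar _ C)); rewrite !scalarE.
rewrite -e -[copairfam (coev (X \ox Y)) _]comp_idl -assocVassoc -[_ \c _ \c copairfam _ _]compA.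
rewrite -coev_dual_ten !compA.
rewrite -(compA (pairfam _ _)) assocV_nat tenm_id !compA pivev_ten.
rewrite -!compA (compA (idm X \om pairfam _ _)) -tenm_compr e.
by rewrite tenmZr tenm_id compZl comp_idl compZr e scalerA mulrC.
Qed.

Lemma tr_scalar X a : tr piv (a *: idm X) = a * qdim piv X.
Proof.
rewrite /qdim /tr compZr comp_idr tenmZl compZr compZl /scalar linearZ //.
Qed.

End Trace.

(** * Schur's lemma *)

Section Eigenvector.
Import VectorInternalTheory.

Lemma eigenvector_of_root (K : fieldType) (V : vectType K) (L : 'End(V)) a :
  root (char_poly (f2mx L)) a -> exists v, v != 0 /\ L v = a *: v.
Proof.
rewrite -eigenvalue_root_char => /eigenvalueP[v vM vN0].
exists (r2v v); split.
  apply: contraNneq vN0 => e.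
  by apply/eqP; rewrite -[v]r2vK e linear0.
by rewrite unlock /= r2vK vM linearZ.
Qed.

Lemma endo_eigenvector (K : closedFieldType) (V : vectType K) (L : V -> V) (v0 : V) :
  (forall a x y, L (a *: x + y) = a *: L x + L y) -> v0 != 0 ->
  exists a v, v != 0 /\ L v = a *: v.
Proof.
move=> Llin v0N0.
pose L' : {linear V -> V} := HB.pack L (GRing.isLinear.Build _ _ _ _ L Llin).
pose M := f2mx (linfun L').
have dV : (0 < dim V)%N.
  by rewrite -dimvf lt0n dimv_eq0; apply: contraNneq v0N0 => e; rewrite -memv0 -e memvf.
have : size (char_poly M) != 1%N by rewrite size_char_poly eqSS -lt0n.
case/closed_rootP => a /eigenvector_of_root[v [vN0 e]].
by exists a, v; split=> //; rewrite -e lfunE.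
Qed.

End Eigenvector.

Section Schur.
Variables (K : closedFieldType) (C : linearCategory K).
Hypothesis Cab : abelian C.
Hypothesis Css : semisimple C.
Implicit Types X Y Z W S : C.

(** The kernel of f is a subobject of X other than X, as f <> 0, hence zero; so f
    is a nonzero subobject of Y. *)
Lemma schur_iso X Y (f : hom X Y) : simple X -> simple Y -> f <> 0 -> is_iso f.
Proof.
move=> sX sY fN0; have [W [k [fk0 kP]]] := ab_ker Cab f.
have mk : mono k.
  move=> V g h e; have fg : f \c (k \c g) = 0 by rewrite compA fk0 comp0l.
  by case: (kP _ _ fg) => u [_ uniq]; rewrite -(uniq g erefl) -(uniq h e).
case: (sX.2 _ k mk) => [W0|[k' [_ kk']]]; last first.
  by case: fN0; rewrite -(comp_idr f) -kk' compA fk0 comp0l.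
have mf : mono f.
  move=> V g h e; have : f \c (g - h) = 0 by rewrite compBr e subrr.
  case/kP => u [+ _]; rewrite (zero_homr u W0) comp0r.
  by move/eqP; rewrite subr_eq0 => /eqP.
by case: (sY.2 _ f mf) => // X0; case: sX.1.
Qed.

(** If g is an eigenvector, for the eigenvalue a, of composition with f on the
    finite-dimensional space End X, then f - a annihilates g, hence is not
    invertible, hence is 0 by Schur's lemma. *)
Lemma simple_scalar X (f : hom X X) : simple X -> exists a, f = a *: idm X.
Proof.
move=> sX; have id0 : idm X != 0 by apply/eqP/sX.1.
case: (@endo_eigenvector _ _ (comp f) _ (fun a x y => comp_linr a f x y) id0).
move=> a [g [gN0 fg]]; exists a; apply/eqP; rewrite -subr_eq0; apply/negP => /negP h.
have /eqP/(schur_iso sX sX) := h; case=> u [uf _]; case/eqP: gN0.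
by rewrite -(comp_idl g) -uf -compA compBl fg compZl comp_idl subrr comp0r.
Qed.

Lemma nonzero_from X Z (f : hom X Z) : f <> 0 ->
  exists S (i : hom S X) (r : hom X S), [/\ simple S, r \c i = idm S & f \c i <> 0].
Proof.
move=> fN0; have [n [Y [sY [i [r [ri _ sum]]]]]] := Css X.
case: (pselect (exists j, f \c i j <> 0)) => [[j rf]|none].
  by exists (Y j), (i j), (r j).
case: fN0; rewrite -(comp_idr f) -sum comp_sumr big1 // => j _.
rewrite compA; case: (pselect (f \c i j = 0)) => [->|rf]; first exact: comp0l.
by case: none; exists j.
Qed.

Lemma split_epi X S (f : hom X S) : simple S -> f <> 0 -> exists s, f \c s = idm S.
Proof.
move=> sS /nonzero_from[T [i [r [sT ri fi]]]].
by have [g [_ e]] := schur_iso sT sS fi; exists (i \c g); rewrite compA.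
Qed.

(** A simple summand S of X gives an idempotent of End X which is a nonzero
    scalar, hence the identity. *)
Lemma scalar_iso_simple X : ~ is_zero X -> (forall f : hom X X, exists a, f = a *: idm X) ->
  exists2 S, simple S & isomorphic S X.
Proof.
move=> XN0 scX; have [S [i [r [sS ri _]]]] := nonzero_from XN0.
exists S => //; exists i; have [a e] := scX (i \c r).
have aN0 : a != 0.
  apply: contra_not_neq sS.1 => a0; rewrite /is_zero.
  have <- : r \c (i \c r) \c i = idm S by rewrite -!compA ri comp_idr.
  by rewrite e a0 scale0r comp0r comp0l.
exists r; split=> //; rewrite e.
have: (i \c r) \c (i \c r) = i \c r by rewrite compA -(compA i) ri comp_idr.
rewrite e compZl compZr comp_idl scalerA => /eqP.
rewrite -subr_eq0 -scalerBl scaler_eq0 => /orP[|/eqP//].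
by rewrite -[X in _ - X]mulr1 -mulrBr mulf_eq0 (negPf aN0) subr_eq0 => /eqP ->; rewrite scale1r.
Qed.

Lemma iso_simple X Y : isomorphic X Y -> simple X -> simple Y.
Proof.
case=> f [g [gf fg]] [XN0 sX]; split.
  by move=> Y0; apply: XN0; rewrite /is_zero -gf (zero_homr f Y0) comp0r.
move=> Z h mh; have mgh : mono (g \c h).
  move=> W u v e; apply: mh; rewrite -(comp_idl (h \c u)) -(comp_idl (h \c v)) -fg -!compA.
  by move: e; rewrite -!compA => ->.
case: (sX _ _ mgh) => [|igh]; [by left | right].
rewrite -(comp_idl h) -fg -compA; apply: is_iso_comp igh.
by exists g; split.
Qed.

Lemma scalar_simple X : ~ is_zero X -> (forall f : hom X X, exists a, f = a *: idm X) ->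
  simple X.
Proof. by move=> h1 h2; have [S sS e] := scalar_iso_simple h1 h2; apply: iso_simple e sS. Qed.

Lemma scalar_inj X a b : ~ is_zero X -> a *: idm X = b *: idm X -> a = b.
Proof.
move=> XN0 /eqP; rewrite -subr_eq0 -scalerBl scaler_eq0 => /orP[|/eqP//].
by rewrite subr_eq0 => /eqP.
Qed.

End Schur.

(** * Tensor products with nonzero and invertible objects *)

Section Fusion.
Variables (K : closedFieldType) (C : fusionCategory K).
Implicit Types X Y Z W S : C.

Let Cab : abelian C := fus_abelian C.
Let Css : semisimple C := @fus_semisimple K C.

Lemma end_scalar X (f : hom X X) : simple X -> exists a, f = a *: idm X.
Proof. exact: simple_scalar. Qed.

(** The zigzag identity recovers g from its composite with the coevaluation. *)
Lemma coev_faithful X Z (g : hom (dual X) Z) :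
  (idm X \om g) \c coev X = 0 -> g = 0.
Proof.
move=> e0; apply: tenr1_inj; rewrite tenm0l.
have e A : (idm X \om (g \om idm A)) \c copairfam (coev X) A = 0.
  by rewrite -copairfam_comp e0 copairfamE tenm0l comp0r comp0l.
by rewrite -[LHS]comp_idr -zigzag_dual compA pairfam_nat -compA -tenm_compr e tenm0r comp0r.
Qed.

Lemma dual_nonzero X : ~ is_zero X -> ~ is_zero (dual X).
Proof.
move=> XN0 d0; apply: XN0; rewrite /is_zero; have [<- _] := dualP X.
have -> : ev X = 0.
  rewrite -[ev X]comp_idr -[idm _]tenm_id; rewrite (_ : idm (dual X) = 0) //.
  by rewrite tenm0l comp0r.
by rewrite tenm0r comp0r !comp0l.
Qed.

Lemma coev_nonzero X : ~ is_zero X -> coev X <> 0.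
Proof.
by move=> XN0 c0; apply: XN0; rewrite /is_zero; have [<- _] := dualP X; rewrite c0 tenm0l comp0r !comp0l.
Qed.

Lemma ev_nonzero X : ~ is_zero X -> ev X <> 0.
Proof.
by move=> XN0 c0; apply: XN0; rewrite /is_zero; have [<- _] := dualP X; rewrite c0 tenm0r comp0r !comp0l.
Qed.

(** The evaluation of X is nonzero, so it splits by semisimplicity and 1 is a
    summand of dual X (x) X; the latter kills f as soon as X does. *)
Lemma ten_faithful X Y Z (f : hom Y Z) : ~ is_zero X -> idm X \om f = 0 -> f = 0.
Proof.
move=> XN0 e0; have [s es] := split_epi Cab Css (one_simple C) (ev_nonzero XN0).
apply: ten1_inj; rewrite tenm0r -es.
have -> : (ev X \c s) \om f = (ev X \om idm Z) \c (idm _ \om f) \c (s \om idm Y).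
  by rewrite -!tenm_comp !comp_idl !comp_idr.
suff -> : idm (dual X \ox X) \om f = 0 by rewrite comp0r comp0l.
apply: (comp_isoIl (assoc_iso _ _ _)).
by rewrite -tenm_id assoc_nat e0 tenm0r comp0l comp0r.
Qed.

Lemma ten_nonzero X Y : ~ is_zero X -> ~ is_zero Y -> ~ is_zero (X \ox Y).
Proof. by move=> XN0 YN0; rewrite /is_zero -tenm_id => /(ten_faithful XN0). Qed.

Lemma iso_end_scalar X Y : isomorphic X Y -> (forall f : hom X X, exists a, f = a *: idm X) ->
  forall f : hom Y Y, exists a, f = a *: idm Y.
Proof.
case=> u [v [vu uv]] sX f; case: (sX (v \c f \c u)) => a e; exists a.
rewrite -[f]comp_idl -[f]comp_idr -uv -!compA (compA f) (compA v) (compA v) e.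
by rewrite compZl comp_idl compZr uv.
Qed.

Lemma invertible_nonzero h : invertible h -> ~ is_zero (h : C).
Proof.
case=> h' [i _] h0; case: (one_simple C) => + _; apply; apply: iso_zero (isomorphic_sym i) _.
by rewrite /is_zero -tenm_id h0 tenm0l.
Qed.

(** Tensoring by an inverse of h turns endomorphisms of h (x) X into those of X,
    which are scalars. *)
Lemma invertible_ten_simple (h X : C) : invertible h -> simple X -> simple (h \ox X).
Proof.
move=> ih sX; have [h' [hh' h'h]] := ih.
have ih' : invertible h' by exists h.
have hN0 := invertible_nonzero ih; have h'N0 := invertible_nonzero ih'.
apply: scalar_simple => //; first exact: ten_nonzero sX.1.
move=> f; have iX : isomorphic (h' \ox (h \ox X)) X.
  apply: isomorphic_trans (isomorphic_sym (isomorphic_assoc _ _ _)) _.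
  apply: isomorphic_trans (isomorphic_ten h'h (isomorphic_refl _)) _.
  exact: isomorphic_lunit.
have [a e] := iso_end_scalar (isomorphic_sym iX) (fun g => end_scalar g sX) (idm h' \om f).
exists a; apply/eqP; rewrite -subr_eq0; apply/eqP; apply: (ten_faithful h'N0).
by rewrite tenmBr e tenmZr tenm_id subrr.
Qed.

Lemma invertible_simple (h : C) : invertible h -> simple h.
Proof.
by move=> ih; apply: iso_simple (isomorphic_runit h) _; apply: invertible_ten_simple (one_simple C).
Qed.

Lemma iso_invertible (h k : C) : isomorphic h k -> invertible h -> invertible k.
Proof.
move=> hk [h' [hh' h'h]]; exists h'; split.
  exact: isomorphic_trans (isomorphic_ten (isomorphic_sym hk) (isomorphic_refl _)) hh'.
exact: isomorphic_trans (isomorphic_ten (isomorphic_refl _) (isomorphic_sym hk)) h'h.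
Qed.

End Fusion.

(** * Double braidings *)

Section Braided.
Variables (K : closedFieldType) (C : braidedFusionCategory K).
Implicit Types X Y Z W S h : C.

Let Cab : abelian C := fus_abelian C.
Let Css : semisimple C := @fus_semisimple K C.

Definition dbraid X Y : hom (X \ox Y) (X \ox Y) := braid Y X \c braid X Y.

Lemma dbraid_nat X X' Y Y' (f : hom X X') (g : hom Y Y') :
  dbraid X' Y' \c (f \om g) = (f \om g) \c dbraid X Y.
Proof. by rewrite /dbraid -compA braid_nat !compA braid_nat. Qed.

Lemma dbraid_iso X Y : is_iso (dbraid X Y).
Proof. by apply: is_iso_comp; apply: braid_iso. Qed.

Lemma braid_tenr X Y Z : braid X (Y \ox Z) = assocV Y Z X \c (idm Y \om braid X Z)
  \c assoc Y X Z \c (braid X Y \om idm Z) \c assocV X Y Z.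
Proof.
rewrite -(compA (assocV Y Z X)) -(compA (assocV Y Z X)) -hexagon.
by rewrite !compA assocVassoc comp_idl -compA assocassocV comp_idr.
Qed.

Lemma braid_tenl X Y Z : braid (X \ox Y) Z = assoc Z X Y \c (braid X Z \om idm Y)
  \c assocV X Z Y \c (idm X \om braid Y Z) \c assoc X Y Z.
Proof.
rewrite -(compA (assoc Z X Y)) -(compA (assoc Z X Y)) -hexagonV.
by rewrite !compA assocassocV comp_idl -compA assocVassoc comp_idr.
Qed.

Definition braids_by X Y (a : K) := dbraid X Y = a *: idm (X \ox Y).

(** Expanding both braidings by the hexagons, the double braiding of h with Y
    sits in the middle; being a scalar, it drops out. *)
Lemma dbraid_tenl h X Y a : braids_by h Y a ->
  dbraid (h \ox X) Y = a *: (assocV h X Y \c (idm h \om dbraid X Y) \c assoc h X Y).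
Proof.
move=> e; rewrite {1}/dbraid braid_tenl braid_tenr !compA.
rewrite -(compA _ (assocV Y h X)) assocVassoc comp_idr.
rewrite -(compA _ (braid Y h \om _)) -tenm_compl -[braid Y h \c _]/(dbraid h Y) e.
rewrite tenmZl tenm_id compZr comp_idr !compZl; congr (_ *: _).
by rewrite -(compA _ (assoc _ _ _)) assocassocV comp_idr -(compA (assocV _ _ _)) -tenm_compr.
Qed.

Lemma dbraid_tenr X Y h b : braids_by X h b ->
  dbraid X (Y \ox h) = b *: (assoc X Y h \c (dbraid X Y \om idm h) \c assocV X Y h).
Proof.
move=> e; rewrite {1}/dbraid braid_tenl braid_tenr !compA.
rewrite -(compA _ (assoc Y h X)) assocassocV comp_idr.
rewrite -(compA _ (idm Y \om braid h X)) -tenm_compr -[braid h X \c _]/(dbraid X h) e.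
rewrite tenmZr tenm_id compZr comp_idr !compZl; congr (_ *: _).
by rewrite -(compA _ (assocV _ _ _)) assocVassoc comp_idr -(compA (assoc _ _ _)) -tenm_compl.
Qed.

Lemma braids_by_sym X Y a : braids_by X Y a -> braids_by Y X a.
Proof.
rewrite /braids_by => e; apply: (comp_isoIr (braid_iso X Y)).
by rewrite /dbraid -compA -/(dbraid X Y) e compZr comp_idr compZl comp_idl.
Qed.

Lemma braids_by_tenr h X Y a b : braids_by h X a -> braids_by h Y b ->
  braids_by h (X \ox Y) (a * b).
Proof.
move=> eX eY; rewrite /braids_by (dbraid_tenr _ eY) eX tenmZl tenm_id.
by rewrite compZr comp_idr compZl assocassocV scalerA mulrC.
Qed.

Lemma braids_by_tenl h k X a b : braids_by h X a -> braids_by k X b ->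
  braids_by (h \ox k) X (a * b).
Proof.
move=> /braids_by_sym eX /braids_by_sym eY.
exact/braids_by_sym/braids_by_tenr.
Qed.

(** Naturality of the double braiding: a nonzero map compares scalars. *)
Lemma braids_by_hom h X Y a b (f : hom X Y) : ~ is_zero h -> f <> 0 ->
  braids_by h X a -> braids_by h Y b -> a = b.
Proof.
move=> hN0 fN0 eX eY; have := dbraid_nat (idm h) f.
rewrite eX eY compZl comp_idl compZr comp_idr => /eqP.
rewrite -subr_eq0 -scalerBl scaler_eq0 subr_eq0 => /orP[/eqP -> //|/eqP].
by move/(ten_faithful hN0).
Qed.

Lemma braids_by_iso h X Y a : isomorphic X Y -> braids_by h X a -> braids_by h Y a.
Proof.
case=> f [g [gf fg]] e; rewrite /braids_by -[LHS]comp_idr -tenm_id -fg tenm_compr compA.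
by rewrite dbraid_nat e compZr comp_idr compZl -tenm_compr.
Qed.

Lemma braids_by_isol h k X a : isomorphic h k -> braids_by h X a -> braids_by k X a.
Proof. by move=> e /braids_by_sym/(braids_by_iso e)/braids_by_sym. Qed.

Lemma braids_by_sum h n (Y : 'I_n -> C) S a :
  (forall i, braids_by h (Y i) a) -> is_direct_sum Y S -> braids_by h S a.
Proof.
move=> eY [i [r [_ _ sum]]]; rewrite /braids_by -[LHS]comp_idr -tenm_id -sum.
rewrite tenm_sumr comp_sumr scaler_sumr; apply: eq_bigr => j _.
by rewrite tenm_compr compA dbraid_nat eY compZr comp_idr compZl.
Qed.

Lemma braids_by_summand h X S a : braids_by h S a -> is_summand X S -> braids_by h X a.
Proof.
move=> eS [i [r ri]]; rewrite /braids_by -[LHS]comp_idl -tenm_id -ri.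
by rewrite tenm_compr -compA -dbraid_nat eS compZl comp_idl compZr.
Qed.

Lemma braids_by_uniq h X a b : ~ is_zero h -> ~ is_zero X ->
  braids_by h X a -> braids_by h X b -> a = b.
Proof.
by move=> hN0 XN0 ea eb; apply: (scalar_inj (ten_nonzero hN0 XN0)); rewrite -ea -eb.
Qed.

Lemma braids_by_neq0 h X a : ~ is_zero h -> ~ is_zero X -> braids_by h X a -> a <> 0.
Proof.
move=> hN0 XN0 + a0; rewrite a0 /braids_by scale0r => e.
have [g [+ _]] := dbraid_iso h X; rewrite e comp0r => /esym.
exact: ten_nonzero.
Qed.

Section Invertible.
Variable h : C.
Hypothesis ih : invertible h.
Let hN0 := invertible_nonzero ih.

Lemma braids_by_ex X : simple X -> exists a, braids_by h X a.
Proof. by move=> sX; apply: end_scalar; apply: invertible_ten_simple. Qed.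

(** By multiplicativity the scalar is idempotent, and it is not 0. *)
Lemma braids_by_one : braids_by h one 1.
Proof.
have [a e] := braids_by_ex (one_simple C).
have lN0 : lunit (one : C) <> 0.
  have [ON0 _] := one_simple C.
  by move=> l0; apply: ON0; rewrite /is_zero -lunitlunitV l0 comp0l.
have := braids_by_hom hN0 lN0 (braids_by_tenr e e) e.
have /eqP aN0 := braids_by_neq0 hN0 (one_simple C).1 e.
move/eqP; rewrite -subr_eq0 -[X in _ - X]mulr1 -mulrBr mulf_eq0 (negPf aN0) subr_eq0.
by move/eqP => <-.
Qed.

(** X need not be simple, so that the lemma also applies to the dual of an
    arbitrary object of the centraliser of h.  For a simple summand Y of dual X
    the coevaluation gives a nonzero map from 1 to X (x) Y, so that the scalars
    of X and Y multiply to 1. *)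
Lemma braids_by_dual X a : ~ is_zero X -> braids_by h X a -> braids_by h (dual X) a^-1.
Proof.
move=> XN0 eX; have /eqP aN0 := braids_by_neq0 hN0 XN0 eX.
have [n [Y [sY dY]]] := Css (dual X); apply: (braids_by_sum _ dY) => i.
have [b eb] := braids_by_ex (sY i); have [inj [r [rinj _ _]]] := dY.
have rN0 : (idm X \om r i) \c coev X <> 0.
  move/coev_faithful => r0; case: (sY i) => + _; apply.
  by rewrite /is_zero -rinj r0 comp0l.
have /esym ab := braids_by_hom hN0 rN0 braids_by_one (braids_by_tenr eX eb).
suff -> : a^-1 = b by [].
by rewrite -[b]mul1r -(mulVf aN0) -mulrA ab mulr1.
Qed.

(** The objects that braid trivially with h form a fusion subcategory; it
    contains all Z (x) dual Z as their scalars a / a are 1. *)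
Lemma braids_by_ad X : ad X -> braids_by h X 1.
Proof.
move=> aX; apply: (aX (fun Y => braids_by h Y 1)); last first.
  move=> Y [Z sZ ->]; have [a ea] := braids_by_ex sZ.
  have /eqP aN0 := braids_by_neq0 hN0 sZ.1 ea.
  rewrite -(mulfV aN0); apply: braids_by_tenr => //.
  exact: braids_by_dual sZ.1 ea.
split=> [|Y Z eY eZ|Y eY|n Y S|Y S].
- exact: braids_by_one.
- by rewrite -[1]mulr1; apply: braids_by_tenr.
- case: (pselect (is_zero Y)) => [Y0|YN0]; last by rewrite -invr1; apply: braids_by_dual.
  suff d0 : is_zero (dual Y).
    rewrite /braids_by scale1r -[dbraid _ _]comp_idr -tenm_id.
    by rewrite [idm (dual Y)]d0 tenm0r comp0r.
  apply: coev_faithful; rewrite tenm_id comp_idl.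
  by rewrite -[coev Y]comp_idl -tenm_id (Y0 : idm Y = 0) tenm0l comp0l.
- exact: braids_by_sum.
- exact: braids_by_summand.
Qed.

End Invertible.

(** By duality, maps from 1 to X (x) dual X correspond to endomorphisms of X,
    and X is simple. *)
Lemma dbraid_coev X : simple X -> exists m, dbraid X (dual X) \c coev X = m *: coev X.
Proof.
move=> sX; set f := dbraid _ _ \c _.
have [m e] := end_scalar (runit X \c (idm X \om ev X) \c assoc X (dual X) X \c
  (f \om idm X) \c lunitV X) sX.
exists m; apply: copairfam_inj => A.
have eA B : (idm X \om pairfam (ev X) B) \c copairfam f (X \ox B) = m *: idm (X \ox B).
  by rewrite -comate_ten e tenmZl tenm_id.
rewrite -[LHS]comp_idl -tenm_id -zigzag_dual tenm_compr -compA -copairfam_nat compA eA.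
by rewrite compZl comp_idl !copairfamE tenmZl compZr compZl.
Qed.

(** With D the double braiding of X with dual X and i : h -> X (x) dual X the map
    induced by phi : h (x) X -> X, the scalar of D on i is computed in two ways,
    moving h past dual X or past X.  The results differ by the square of b. *)
Lemma fixed_braids_by_sq h X b : invertible h -> simple X -> isomorphic (h \ox X) X ->
  braids_by h X b -> b * b = 1.
Proof.
move=> ih sX [phi iphi] eX; have hN0 := invertible_nonzero ih.
have eXd := braids_by_dual ih sX.1 eX.
have [m em] := dbraid_coev sX.
pose i := (phi \om idm (dual X)) \c assocV h X (dual X) \c (idm h \om coev X) \c runitV h.
have i1 : dbraid X (dual X) \c i = (b^-1 * m) *: i.
  rewrite /i !compA dbraid_nat (dbraid_tenl _ eXd).
  rewrite !compZr !compZl -scalerA; congr (_ *: _).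
  rewrite !compA -(compA _ (assoc _ _ _)) assocassocV comp_idr.
  by rewrite -(compA _ (idm h \om dbraid _ _)) -tenm_compr em tenmZr compZr compZl.
(* The map inside idm X is a map dual X (x) h -> dual X inducing i. *)
have i_eq : i = (idm X \om (pairfam (ev X) (dual X) \c (idm (dual X) \om i))) \c
    copairfam (coev X) h.
  by rewrite tenm_compr -compA -copairfam_nat compA zigzag comp_idl.
have i2 : dbraid X (dual X) \c i = (b * m) *: i.
  rewrite {1}i_eq compA dbraid_nat (dbraid_tenr _ (braids_by_sym eX)).
  rewrite !compZr !compZl -scalerA; congr (_ *: _).
  rewrite [in RHS]i_eq copairfamE !compA -(compA _ (assocV _ _ _)) assocVassoc comp_idr.
  by rewrite -(compA _ (dbraid _ _ \om _)) -tenm_compl em tenmZl compZr compZl.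
have iN0 : i <> 0.
  move=> i0; apply: (coev_nonzero sX.1); apply: (ten_faithful hN0).
  apply: (comp_isoIr (runitV_iso h)); rewrite comp0l.
  apply: (comp_isoIl (is_iso_comp (tenm_iso iphi (is_iso_id (dual X))) (assocV_iso h X (dual X)))).
  by rewrite compA -/i comp0r.
have mN0 : m != 0.
  apply/eqP => m0; apply: iN0; apply: (comp_isoIl (dbraid_iso X (dual X))).
  by rewrite i1 m0 mulr0 scale0r comp0r.
have /eqP bN0 := braids_by_neq0 hN0 sX.1 eX.
have /eqP := i2; rewrite i1 -subr_eq0 -scalerBl scaler_eq0 subr_eq0 => /orP[|/eqP//].
by move/eqP/(mulIf mN0) => e; rewrite -{1}e mulVf.
Qed.

End Braided.

(** * The group of invertible simple objects *)

Lemma bigmax_only1 (s : seq algC) : 1 \in s -> (forall a, a \in s -> 0 <= a -> a = 1) ->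
  \big[Num.max/0]_(a <- s | 0 <= a) a = 1.
Proof.
move=> s1 sP; have : \big[Num.max/0]_(a <- s | 0 <= a) a =
    (has (fun a : algC => 0 <= a) s)%:R.
  elim: s {s1} sP => [|a s IHs] sP; first by rewrite big_nil.
  rewrite big_cons IHs => [|b bs]; last by apply: sP; rewrite inE bs orbT.
  rewrite /=; case: ifP => //= a0; rewrite (sP a) ?inE ?eqxx // /Num.max.
  by case: has; rewrite ?ltxx // ltr10.
by move=> ->; have -> // : has (fun a : algC => 0 <= a) s; apply/hasP; exists 1.
Qed.

(** The constant vector is fixed, and an eigenvalue of a permutation of order m
    is an m-th root of unity; 1 is the only nonnegative one. *)
Lemma max_nneg_eigenvalue_perm n (s : 'S_n) : (0 < n)%N ->
  max_nneg_eigenvalue (perm_mx s : 'M[algC]_n) = 1.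
Proof.
move=> n_gt0; rewrite /max_nneg_eigenvalue; set M : 'M_n := perm_mx s.
case: (closed_field_poly_normal _) => /= rs Mrs.
have rsE a : (a \in rs) = eigenvalue M a.
  rewrite eigenvalue_root_char Mrs (monicP (char_poly_monic M)) scale1r.
  by rewrite root_prod_XsubC.
have permE_row (v : 'rV_n) k : (v *m M) 0 (s k) = v 0 k.
  by rewrite /M -[s in perm_mx s]invgK -col_permE mxE permK.
apply: bigmax_only1 => [|a]; rewrite rsE.
  apply/eigenvalueP; exists (const_mx 1).
    apply/rowP => k; rewrite scale1r -[k](permKV s) permE_row !mxE //.
  apply/eqP => /rowP /(_ (Ordinal n_gt0)); rewrite !mxE => /eqP.
  by rewrite oner_eq0.
case/eigenvalueP => v vM /rV0Pn[k vk] a_ge0.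
have iter_act m : v 0 k = a ^+ m * v 0 ((s ^+ m)%g k).
  elim: m => [|m IHm]; first by rewrite mul1r perm1.
  by rewrite IHm -permE_row vM mxE expgSr permM exprSr mulrA.
have /eqP := iter_act #[s]%g; rewrite expg_order perm1 -subr_eq0 -[X in X - _]mul1r -mulrBl.
rewrite mulf_eq0 (negPf vk) orbF subr_eq0 eq_sym pexpr_eq1 ?order_gt0 //.
by move/eqP.
Qed.

Section Invertibles.
Variables (K : closedFieldType) (C : braidedFusionCategory K).
Implicit Types X Y Z W S h : C.

Let Cab : abelian C := fus_abelian C.
Let Css : semisimple C := @fus_semisimple K C.

Lemma dim_hom_simple S T : simple S -> simple T ->
  \dim {: hom S T} = `[<isomorphic S T>].
Proof.
move=> sS sT; case: asboolP => [[f if_]|nST]; last first.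
  apply/eqP; rewrite dimv_eq0; apply/eqP/vspaceP => f; rewrite memvf memv0.
  apply/esym/eqP; apply: contrapT => /(schur_iso Cab sS sT) i.
  by apply: nST; exists f.
have fN0 : f != 0.
  apply/eqP => f0; case: if_ => g [+ _]; rewrite f0 comp0r => /esym.
  by case: sS.
suff -> : {: hom S T}%VS = <[f]>%VS by rewrite dim_vline fN0.
apply/vspaceP => g; rewrite memvf; apply/esym/vlineP.
case: (if_) => f' [f'f ff']; have [a e] := end_scalar (f' \c g) sS.
by exists a; rewrite -[LHS]comp_idl -ff' -compA e compZr comp_idr.
Qed.

Lemma iso_braid X Y : isomorphic (X \ox Y) (Y \ox X).
Proof. by exists (braid X Y); apply: braid_iso. Qed.

(** As for coev_faithful, the zigzag identity recovers f from the pairing. *)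
Lemma mate_faithful S X (f : hom S (dual X)) : ev X \c (f \om idm X) = 0 -> f = 0.
Proof.
move=> e0; apply: tenr1_inj; rewrite tenm0l -[LHS]comp_idl -zigzag_dual -compA tenm_exch compA.
by rewrite -tenm_id -pairfam_comp e0 pairfamE tenm0l comp0r !comp0l.
Qed.

(** Objects all of whose simple constituents are invertible form a fusion
    subcategory.  For products, constituents of X (x) Y are products of
    invertible constituents.  For duals, a constituent T of dual X pairs
    nontrivially with some constituent of X, which by Schur's lemma is inverse
    to T. *)
Lemma pt_invertible S : simple S -> pt S -> invertible S.
Proof.
move=> sS ptS.
pose P X := forall T (f : hom T X), simple T -> f <> 0 -> invertible T.
suff : P S by move/(_ S (idm S)); apply => //; case: sS.
apply: ptS => [|h ih T f sT]; last first.
  move/(schur_iso Cab sT (invertible_simple ih)) => i.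
  by apply: iso_invertible ih; apply: isomorphic_sym; exists f.
split.
- move=> T f sT /(schur_iso Cab sT (one_simple C)) i.
  by apply: iso_invertible (invertible_one C); apply: isomorphic_sym; exists f.
- move=> X Y PX PY T f sT fN0.
  have [n [A [sA [iA [rA [riA _ sumA]]]]]] := Css X.
  have [m [B [sB [iB [rB [riB _ sumB]]]]]] := Css Y.
  have [[u v] uvN0] : exists ab, (rA ab.1 \om rB ab.2) \c f <> 0.
    apply: contrapT => none; apply: fN0.
    rewrite -[f]comp_idl -tenm_id -sumA -sumB tenm_suml comp_suml big1 // => u _.
    rewrite tenm_sumr comp_suml big1 // => v _; rewrite tenm_comp -compA.
    have -> : (rA u \om rB v) \c f = 0; last exact: comp0r.
    by apply: contrapT => h; apply: none; exists (u, v).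
  have iu : invertible (A u).
    apply: (PX _ (iA u)) => // i0; case: (sA u) => + _; apply.
    by rewrite /is_zero -riA i0 comp0r.
  have iv : invertible (B v).
    apply: (PY _ (iB v)) => // i0; case: (sB v) => + _; apply.
    by rewrite /is_zero -riB i0 comp0r.
  have iuv := invertible_ten iu iv.
  move/(schur_iso Cab sT (invertible_simple iuv)): uvN0 => i.
  by apply: iso_invertible iuv; apply: isomorphic_sym; eexists; exact: i.
- move=> X PX T f sT fN0.
  set g := ev X \c (f \om idm X) \c braid X T.
  have gN0 : g <> 0.
    by rewrite -[0](comp0l _ (braid X T)) => /(comp_isoIr (braid_iso X T))/mate_faithful.
  have [n [A [sA [iA [rA [riA _ sumA]]]]]] := Css X.
  have [u uN0] : exists u, g \c (iA u \om idm T) <> 0.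
    apply: contrapT => none; apply: gN0.
    rewrite -[g]comp_idr -tenm_id -sumA tenm_suml comp_sumr big1 // => u _.
    rewrite tenm_compl compA.
    have -> : g \c (iA u \om idm T) = 0; last exact: comp0l.
    by apply: contrapT => h; apply: none; exists u.
  have iu : invertible (A u).
    apply: (PX _ (iA u)) => // i0; case: (sA u) => + _; apply.
    by rewrite /is_zero -riA i0 comp0r.
  have sAT := invertible_ten_simple iu sT.
  have iso1 : isomorphic (A u \ox T) one.
    by eexists; exact: (schur_iso Cab sAT (one_simple C) uN0).
  by exists (A u); split=> //; apply: isomorphic_trans (iso_braid _ _) iso1.
- move=> n Y S0 PY [i [r [_ _ sum]]] T f sT fN0.
  have [u uN0] : exists u, r u \c f <> 0.
    apply: contrapT => none; apply: fN0.
    rewrite -[f]comp_idl -sum comp_suml big1 // => u _; rewrite -compA.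
    have -> : r u \c f = 0; last exact: comp0r.
    by apply: contrapT => h; apply: none; exists u.
  exact: PY uN0.
- move=> X S0 PS [i [r ri]] T f sT fN0; apply: (PS _ (i \c f)) => // e0.
  by apply: fN0; rewrite -[f]comp_idl -ri -compA e0 comp0r.
Qed.

Lemma invertible_pt h : invertible h -> pt h.
Proof. by move=> ih P _; apply. Qed.

Let r := rank C.

Definition tensor_index (h : C) (j : 'I_r) : 'I_r :=
  odflt j [pick k | `[<isomorphic (h \ox irr C j) (irr C k)>]].

Lemma tensor_indexP h j : invertible h ->
  isomorphic (h \ox irr C j) (irr C (tensor_index h j)).
Proof.
move=> ih; rewrite /tensor_index; case: pickP => [k /asboolP//|none].
have [k e] := irr_surj (invertible_ten_simple ih (irr_simple j)).
by have /asboolP := none k.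
Qed.

Lemma tensor_index_uniq h j k : invertible h ->
  isomorphic (h \ox irr C j) (irr C k) -> tensor_index h j = k.
Proof.
move=> ih e; apply: irr_inj; apply: isomorphic_trans e.
exact: isomorphic_sym (tensor_indexP j ih).
Qed.

Lemma tensor_index_inj h : invertible h -> injective (tensor_index h).
Proof.
move=> ih j k e; have [h' [hh' h'h]] := ih; apply: irr_inj.
have u i : isomorphic (h' \ox irr C (tensor_index h i)) (irr C i).
  apply: isomorphic_trans (isomorphic_lunit _).
  apply: isomorphic_trans (isomorphic_ten h'h (isomorphic_refl _)).
  apply: isomorphic_trans (isomorphic_sym (isomorphic_assoc _ _ _)).
  exact: isomorphic_ten (isomorphic_refl _) (isomorphic_sym (tensor_indexP _ ih)).
by apply: isomorphic_trans (u k); rewrite -e; apply: isomorphic_sym.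
Qed.

(** Left multiplication by the i-th simple object, with value 1 when that object
    is not invertible.  Realising the group of invertible objects inside the
    symmetric group on the simple objects makes the theory of finite
    permutation groups applicable. *)
Definition tensor_perm (i : 'I_r) : 'S_r :=
  if pselect (invertible (irr C i)) is left ih then perm (tensor_index_inj ih) else 1%g.

Lemma tensor_permE i j : invertible (irr C i) -> tensor_perm i j = tensor_index (irr C i) j.
Proof. by move=> ih; rewrite /tensor_perm; case: pselect => // ih'; rewrite permE. Qed.

Lemma FPdim_invertible i : invertible (irr C i) -> FPdim i = 1.
Proof.
move=> ih; have r_gt0 : (0 < r)%N by apply: leq_ltn_trans (ltn_ord i).
rewrite -(max_nneg_eigenvalue_perm (tensor_perm i) r_gt0); congr max_nneg_eigenvalue.
apply/matrixP => j k; rewrite !mxE tensor_permE // /fusion_coef dim_hom_simple; last 2 first.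
- exact: irr_simple.
- exact: invertible_ten_simple (irr_simple j).
congr (_%:R); congr nat_of_bool; apply/asboolP/eqP => [e|<-].
  exact: tensor_index_uniq (isomorphic_sym e).
exact/isomorphic_sym/tensor_indexP.
Qed.

Definition invertible_indices : {set 'I_r} := [set i | `[<invertible (irr C i)>]].

Lemma invertible_indicesP i : reflect (invertible (irr C i)) (i \in invertible_indices).
Proof. by rewrite inE; apply: asboolP. Qed.

Lemma FPdim_sub_pt : FPdim_sub (@pt K C) = #|invertible_indices|%:R.
Proof.
rewrite /FPdim_sub (eq_bigl (mem invertible_indices)) => [|i].
  rewrite (eq_bigr (fun=> 1)) => [|i /invertible_indicesP ii]; first by rewrite sumr_const.
  by rewrite FPdim_invertible // expr1n.
apply/asboolP/invertible_indicesP; first exact/pt_invertible/irr_simple.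
exact: invertible_pt.
Qed.

(** Permutations compose from left to right, whence the reversal of i and j. *)
Lemma tensor_permM i j : invertible (irr C i) -> invertible (irr C j) ->
  (tensor_perm i * tensor_perm j)%g = tensor_perm (tensor_index (irr C j) i).
Proof.
move=> ii ij; have iso := tensor_indexP i ij.
have iji := iso_invertible iso (invertible_ten ij ii).
apply/permP => x; rewrite permM !tensor_permE //; apply/esym/tensor_index_uniq => //.
apply: isomorphic_trans (isomorphic_ten (isomorphic_sym iso) (isomorphic_refl _)) _.
apply: isomorphic_trans (isomorphic_assoc _ _ _) _.
apply: isomorphic_trans (tensor_indexP _ ij).
exact: isomorphic_ten (isomorphic_refl _) (tensor_indexP _ ii).
Qed.

Lemma irr_one_ex : exists u : 'I_r, isomorphic one (irr C u).
Proof. exact/irr_surj/one_simple. Qed.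

Lemma tensor_perm_unit i u :
  isomorphic one (irr C u) -> invertible (irr C i) -> tensor_perm i u = i.
Proof.
move=> eu ii; rewrite tensor_permE //; apply: tensor_index_uniq => //.
apply: isomorphic_trans (isomorphic_runit _).
exact: isomorphic_ten (isomorphic_refl _) (isomorphic_sym eu).
Qed.

(** An invertible object is recovered as the image of the unit object. *)
Lemma tensor_perm_inj : {in invertible_indices &, injective tensor_perm}.
Proof.
move=> i j /invertible_indicesP ii /invertible_indicesP ij e; have [u eu] := irr_one_ex.
by rewrite -(tensor_perm_unit eu ii) e tensor_perm_unit.
Qed.

Fact tensor_perm_group_set : group_set (tensor_perm @: invertible_indices).
Proof.
apply/group_setP; split.
  have [u eu] := irr_one_ex; have iu := iso_invertible eu (invertible_one C).
  apply/imsetP; exists u; first exact/invertible_indicesP.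
  apply/permP => x; rewrite perm1 tensor_permE //; apply/esym/tensor_index_uniq => //.
  apply: isomorphic_trans (isomorphic_lunit _).
  exact: isomorphic_ten (isomorphic_sym eu) (isomorphic_refl _).
move=> s t /imsetP[i /invertible_indicesP ii ->] /imsetP[j /invertible_indicesP ij ->].
rewrite tensor_permM //; apply: imset_f; apply/invertible_indicesP.
exact: iso_invertible (tensor_indexP i ij) (invertible_ten ij ii).
Qed.
Canonical tensor_perm_group := Group tensor_perm_group_set.

Lemma card_tensor_perm_group : #|tensor_perm_group| = #|invertible_indices|.
Proof. exact: card_in_imset tensor_perm_inj. Qed.

(** In a group of odd order n, x is the square of x ^+ (n + 1)./2. *)
Lemma invertible_square_root i : odd #|invertible_indices| -> i \in invertible_indices ->
  exists2 j, invertible (irr C j) & isomorphic (irr C j \ox irr C j) (irr C i).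
Proof.
move=> oddI iI; have sG : tensor_perm i \in tensor_perm_group by apply: imset_f.
have /imsetP[j /invertible_indicesP ij sj] := groupX (#|invertible_indices|.+1./2) sG.
exists j => //; suff -> : i = tensor_index (irr C j) j by apply: tensor_indexP.
apply: tensor_perm_inj => //.
  by apply/invertible_indicesP; apply: iso_invertible (tensor_indexP j ij) (invertible_ten ij ij).
rewrite -tensor_permM // -sj -expgD addnn halfK /= oddI subn0.
by rewrite expgSr -card_tensor_perm_group expg_cardG ?mul1g.
Qed.

End Invertibles.

(** * Degrees of simple objects *)

Section Grading.
Variables (K : closedFieldType) (C : fusionCategory K) (G : groupType) (A : G -> C -> Prop).
Hypothesis grA : grading A.
Implicit Types X Y Z : C.

Let Cab : abelian C := fus_abelian C.
Let Css : semisimple C := @fus_semisimple K C.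

Lemma grade_iso g X Y : isomorphic X Y -> A g X -> A g Y.
Proof.
case=> u [v [_ uv]] aX; apply: (gr_summand grA aX).
by exists v, u.
Qed.

Lemma grade_uniq g h X : ~ is_zero X -> A g X -> A h X -> g = h.
Proof.
move=> XN0 aX bX; apply: contrapT => /eqP gh; apply: XN0.
exact: (gr_orth grA gh aX bX).
Qed.

Lemma grade_hom g h X Y (f : hom X Y) : f <> 0 -> A g X -> A h Y -> g = h.
Proof.
by move=> fN0 aX bY; apply: contrapT => /eqP gh; apply: fN0; apply: (gr_orth grA gh).
Qed.

Lemma simple_grade_ex X : simple X -> exists g, A g X.
Proof.
move=> sX; have [n [g [Y [aY [i [r [_ _ sum]]]]]]] := gr_decomp grA X.
have [j irN0] : exists j, i j \c r j <> 0.
  apply: contrapT => none; case: sX => + _; apply; rewrite /is_zero -sum big1 // => j _.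
  by apply: contrapT => h; apply: none; exists j.
exists (g j); apply: (gr_summand grA (aY j)).
have [a e] := end_scalar (i j \c r j) sX.
have aN0 : a != 0 by apply/eqP => a0; apply: irN0; rewrite e a0 scale0r.
by exists (r j), (a^-1 *: i j); rewrite compZl e scalerA mulVf // scale1r.
Qed.

(** A simple summand Y of dual X receives, via the coevaluation, a nonzero map
    1 -> X (x) Y, so the degrees of X and Y are inverse. *)
Lemma grade_dual g X : A 1%g one -> A g X -> A g^-1%g (dual X).
Proof.
move=> a1 aX; have [n [Y [sY dY]]] := Css (dual X).
apply: (gr_sum grA _ dY) => i; have [h ah] := simple_grade_ex (sY i).
suff -> : g^-1%g = h by [].
have [inj [r [rinj _ _]]] := dY.
have rN0 : (idm X \om r i) \c coev X <> 0.
  move/coev_faithful => r0; case: (sY i) => + _; apply.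
  by rewrite /is_zero -rinj r0 comp0l.
have e := grade_hom rN0 a1 (gr_ten grA aX ah).
by rewrite -[LHS]mulg1 e mulKg.
Qed.

End Grading.

(** * Fixed points have trivial degree *)

Section Modular.
Variables (K : closedFieldType) (C : modularCategory K).
Variable A : invgroup C -> C -> Prop.
Hypothesis A_universal : universal_grading A.
Implicit Types X Y Z : C.

Let r := rank C.
Let grA : grading A. Proof. by case: A_universal. Qed.

Lemma ad_one : A 1%g one.
Proof. by case: A_universal => _ _ ->; move=> P subP _; apply: fsub_one. Qed.

(** X (x) dual Y has degree 1, hence lies in ad C and braids trivially with h;
    its scalar is also a / b. *)
Lemma braids_by_grade (h : C) g X Y a b : invertible h -> simple X -> simple Y ->
  A g X -> A g Y -> braids_by h X a -> braids_by h Y b -> a = b.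
Proof.
move=> ih sX sY aX aY eX eY; have hN0 := invertible_nonzero ih.
have /eqP bN0 := braids_by_neq0 hN0 sY.1 eY.
have adXY : ad (X \ox dual Y).
  case: A_universal => _ _ <-; rewrite -(mulgV g).
  by apply: gr_ten => //; apply: grade_dual => //; apply: ad_one.
have e1 := braids_by_ad ih adXY.
have e2 := braids_by_tenr eX (braids_by_dual ih sY.1 eY).
have XYN0 := ten_nonzero sX.1 (dual_nonzero sY.1).
have e : a / b = 1 := braids_by_uniq hN0 XYN0 e2 e1.
by rewrite -[a](mulfVK bN0) e mul1r.
Qed.

Lemma invgroup_irr (g : invgroup C) : exists j : 'I_r, invertible (irr C j) /\
  g = iso_class (irr C j) :> (C -> Prop).
Proof.
have [X iX gX] := invclP g; have [j e] := irr_surj (invertible_simple iX).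
exists j; split; first exact: iso_invertible e iX.
by rewrite gX (iso_class_eq e).
Qed.

Let qd (i : 'I_r) := qdim (@piv K C) (irr C i).

Lemma Smatrix_invertible i j a : braids_by (irr C i) (irr C j) a ->
  Smatrix (@piv K C) i j = a * (qd i * qd j).
Proof.
move=> e; have [pivC _] := pivP C.
have one_sc (f : hom (one : C) one) := end_scalar f (one_simple C).
rewrite mxE -[braid _ _ \c _]/(dbraid _ _) e tr_scalar qdim_ten //.
Qed.

(** The proof is by contradiction: if the degree g of X is not 1, then the columns
    g and 1 of the matrix (qdim h * b(h, c)) coincide, so the matrix is singular,
    and a nonzero vector in its left kernel is also in that of the S-matrix,
    whose rows at invertible objects factor through it. *)
Lemma centralizer_pt_grade g X : simple X -> A g X ->
  (forall i : 'I_r, invertible (irr C i) -> braids_by (irr C i) X 1) -> g = 1%g.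
Proof.
move=> sX aX cX.
have [gr grP] := choice (fun i : 'I_r => simple_grade_ex grA (irr_simple i)).
have [gi giP] := choice invgroup_irr.
have gi_inj : injective gi.
  by move=> c d e; apply: invcl_inj; case: (giP c) (giP d) => [_ ->] [_ ->]; rewrite e.
have bP (i j : 'I_r) : exists b, invertible (irr C i) -> braids_by (irr C i) (irr C j) b.
  case: (pselect (invertible (irr C i))) => [ii|]; last by exists 0.
  by have [b e] := braids_by_ex ii (irr_simple j); exists b.
pose b0 i := projT1 (choice (bP i)).
have b0P i := projT2 (choice (bP i)).
have [x ex] := irr_surj sX; have [u eu] := irr_surj (one_simple C).
have grx : gr x = g.
  exact: (grade_uniq grA (irr_simple x).1 (grP x) (grade_iso grA ex aX)).
have gru : gr u = 1%g.
  exact: (grade_uniq grA (irr_simple u).1 (grP u) (grade_iso grA eu ad_one)).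
apply: contrapT => gN1.
(* bb i j is the scalar of i on any simple object whose degree is the class
   of j. *)
pose bb (i j : 'I_r) := if [pick y | gi (gr y) == j] is Some y then b0 i y else 0.
have bbE i y : invertible (irr C i) -> bb i (gi (gr y)) = b0 i y.
  move=> ii; rewrite /bb; case: pickP => [z /eqP/gi_inj e|/(_ y)]; last by rewrite eqxx.
  apply: (braids_by_grade ii (irr_simple z) (irr_simple y) (g := gr y)) => //.
  - by rewrite -e.
  - exact: b0P.
  - exact: b0P.
(* B is the matrix of the factorisation, completed by the identity outside the
   invertible indices, so that vectors of its left kernel vanish there. *)
pose B : 'M[K]_r := \matrix_(i, j)
  if i \in invertible_indices C then
    (if j \in invertible_indices C then qd i * bb i j else 0)
  else (i == j)%:R.
have giI c : gi c \in invertible_indices C by apply/invertible_indicesP; case: (giP c).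
have bx i : invertible (irr C i) -> b0 i x = 1.
  move=> ii; apply: (braids_by_uniq (irr_simple i).1 (irr_simple x).1 (b0P _ _ ii)).
  exact: braids_by_iso ex (cX i ii).
have bu i : invertible (irr C i) -> b0 i u = 1.
  move=> ii; apply: (braids_by_uniq (irr_simple i).1 (irr_simple u).1 (b0P _ _ ii)).
  exact: braids_by_iso eu (braids_by_one ii).
have : \det B = 0.
  rewrite -det_tr; apply: (@determinant_alternate _ _ _ (gi g) (gi 1%g)).
    by apply: contra_notN gN1 => /eqP/gi_inj.
  move=> i; rewrite !mxE; case: ifP => [iI|iI].
    rewrite !giI -{1}grx -gru !bbE ?bx ?bu //; exact/invertible_indicesP.
  have iN c : (i == gi c) = false by apply: contraFF iI => /eqP ->.
  by rewrite !iN.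
move/eqP/det0P => [v vN0 vB].
have vI j : j \notin invertible_indices C -> v 0 j = 0.
  move=> jI; have /rowP/(_ j) := vB; rewrite !mxE (bigD1 j) //= big1 => [|i ij].
    by rewrite mxE (negPf jI) eqxx mulr1 addr0.
  by rewrite mxE (negPf jI) (negPf ij); case: ifP; rewrite mulr0.
suff : v *m Smatrix (@piv K C) = 0.
  move/(congr1 (mulmx^~ (invmx (Smatrix (@piv K C))))).
  by rewrite mulmxK ?SmatrixP // mul0mx => v0; rewrite v0 eqxx in vN0.
apply/rowP => y; rewrite [RHS]mxE.
transitivity ((v *m B) 0 (gi (gr y)) * qd y); last by rewrite vB mxE mul0r.
rewrite mxE [in RHS]mxE mulr_suml; apply: eq_bigr => i _.
case: (boolP (i \in invertible_indices C)) => iI; last by rewrite vI // !mul0r.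
have /invertible_indicesP ii := iI.
rewrite (Smatrix_invertible (b0P i y ii)) mxE iI giI bbE //.
by rewrite -!mulrA; congr (_ * _); rewrite mulrCA.
Qed.

(** The scalars b(h, X) are signs, and every h is a square, so they are all 1. *)
Lemma fixed_grade g X : odd #|invertible_indices C| -> simple X -> A g X ->
  (forall i : 'I_r, invertible (irr C i) -> isomorphic (irr C i \ox X) X) -> g = 1%g.
Proof.
move=> oddI sX aX fixX; apply: (centralizer_pt_grade sX aX) => i ii.
have /invertible_indicesP iI := ii; have [j ij ej] := invertible_square_root oddI iI.
have [b eb] := braids_by_ex ij sX.
rewrite -(fixed_braids_by_sq ij sX (fixX j ij) eb).
by apply: braids_by_isol ej _; apply: braids_by_tenl.
Qed.

End Modular.

Theorem proposition5p6 (K : closedFieldType) (charK : [pchar K] =i pred0)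
    (C : modularCategory K) (p k : nat)
    (C_nonpointed : ~ pointed C)
    (pt_sub_ad : forall X : C, pt X -> ad X)
    (p_prime : prime p) (p_odd : odd p)
    (FPdim_pt : FPdim_sub (@pt K C) = ((p ^ k)%N)%:R)
    (A : invgroup C -> C -> Prop) (A_universal : universal_grading A)
    (g : invgroup C) (g_neq1 : g <> 1%g) :
  rank_sub (A g) = 0%N %[mod p].
Proof.
have grA : grading A by case: A_universal.
have cardI : #|invertible_indices C| = (p ^ k)%N.
  by apply/eqP; rewrite -(eqr_nat algC) -FPdim_sub_pt FPdim_pt.
have oddI : odd #|invertible_indices C| by rewrite cardI oddX p_odd orbT.
pose S := [set i : 'I_(rank C) | `[< A g (irr C i) >]].
have -> : rank_sub (A g) = #|S| by apply: eq_card => i; rewrite !inE.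
have pG : (p.-group (tensor_perm_group C))%g.
  by rewrite /pgroup card_tensor_perm_group cardI pnatX pnat_id.
have actS : ([acts tensor_perm_group C, on S | 'P])%g.
  apply/subsetP => s /imsetP[i /invertible_indicesP ii ->].
  rewrite inE; apply/andP; split; first by rewrite inE.
  rewrite inE; apply/subsetP => j; rewrite !inE => /asboolP aj; apply/asboolP.
  rewrite /= /perm.aperm tensor_permE //; apply: (grade_iso grA (tensor_indexP j ii)).
  rewrite -(mul1g g).
  apply: gr_ten => //; case: A_universal => _ _ ->.
  by apply: pt_sub_ad; apply: invertible_pt.
have -> := pgroup_fix_mod pG actS.
suff -> : #|('Fix_(S | 'P)(tensor_perm_group C))%g| = 0%N by [].
apply: eq_card0 => j; apply/negP; rewrite in_setI => /andP[jS jF].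
have aj : A g (irr C j) by move: jS; rewrite inE => /asboolP.
case: g_neq1.
apply: (fixed_grade A_universal oddI (irr_simple j) aj) => i ii.
have sG : tensor_perm i \in tensor_perm_group C by apply: imset_f; apply/invertible_indicesP.
have /afixP/(_ _ sG) := jF; rewrite /= /perm.aperm tensor_permE // => e.
by rewrite -[X in isomorphic _ (irr C X)]e; apply: tensor_indexP.
Qed.
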